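(* Let $\mathcal{M}$ be a countable $\mathcal L$-structure with $\mathcal{M}\models\mathrm{MOST}+\Delta_0^{\mathcal P}\text{-collection}$, let $I\subseteq M$ be an $H$-cut of $\mathcal M$, let $\mathcal I=\langle I,\in^{\mathcal M}\rangle$, and let $\bar\kappa\in\mathrm{Ord}^{\mathcal M}\setminus\mathrm{Ord}^{\mathcal I}$ with $\mathcal M\models(\bar\kappa\text{ is a regular cardinal})$. Then there exists a non-principal ultrafilter $\mathcal U\subseteq(\mathcal P(\bar\kappa)^{\mathcal M})^*$ which is $I$-complete, canonically Ramsey and $I$-tight, and such that $\{|X|^{\mathcal M}:X\in\mathcal U\}$ is downward cofinal in $\mathrm{Ord}^{\mathcal M}\setminus\mathrm{Ord}^{\mathcal I}$.
   Context: $\mathcal{L}$ is the language with one binary relation $\in$; for $a\in M$, $a^*=\{x\in M:\mathcal M\models x\in a\}$. $\mathrm{Mac}$: extensionality, pairing, emptyset, union, infinity, powerset, transitive containment, $\Delta_0$-separation, set foundation, and ''every set can be well-ordered''. $\mathrm{MOST}=\mathrm{Mac}+\Sigma_1$-separation$+\Delta_0$-collection. $\Delta_0^{\mathcal P}$-collection is the collection scheme restricted to formulae built from atomic formulae using connectives and bounded quantifiers $\exists x\in y,\forall x\in y,\exists x\subseteq y,\forall x\subseteq y$. For $\mathcal{L}$-structures $\mathcal{A}\subseteq\mathcal{B}$: end-extension means members (in $\mathcal B$) of elements of $A$ lie in $A$; powerset-preserving means additionally every $x\in B$ with $\mathcal B\models x\subseteq y$ for some $y\in A$ lies in $A$; topless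 means end-extension, $A\ne B$, and every $C\in B$ with $C^*\subseteq\mathrm{Ord}^{\mathcal A}$ lies in $A$. For $\mathcal M\models\mathrm{MOST}$, $I\subseteq M$ is an $H$-cut if $\mathcal M$ is a topless powerset-preserving end-extension of $\langle I,\in^{\mathcal M}\rangle$ and $\langle I,\in^{\mathcal M}\rangle\models\mathrm{MOST}$. An $\mathcal M$-cardinal is $I$-large if not in $I$. The ultrafilter $\mathcal U$ is an (external) ultrafilter on the Boolean algebra $(\mathcal P(\bar\kappa)^{\mathcal M})^*$ of $\mathcal M$'s subsets of $\bar\kappa$. Below $n$ ranges over standard natural numbers and $f\in M$. $\mathcal U$ is $I$-complete if whenever $\mathcal M\models f:[\bar\kappa]^n\to\mathrm{TC}(A)$ with $A\in I$, there is $X\in\mathcal U$ with $\mathcal M\models(f\text{ is constant on }[X]^n)$. $\mathcal U$ is canonically Ramsey if whenever $\mathcal M\models(f\text{ is a function with domain }[\bar\kappa]^n)$ there is $X\in\mathcal U$ such that $\mathcal M\models(X\text{ is }f\text{-canonical})$, where $H$ is $f$-canonical if there is $\Delta\subseteq n$ with: for all $s_0<\dots<s_{n-1}$, $t_0<\dots<t_{n-1}$ in $H$, $f(\{s_i\}_i)=f(\{t_i\}_i)$ iff $s_i=t_i$ for all $i\in\Delta$. $\mathcal U$ is $I$-tight if whenever $\mathcal M\models(f\text{ is a function with domain }[\bar\kappa]^n)$ there is $X\in\mathcal U$ such that either $\mathcal M\models(f\text{ is constant on }[X]^n)$, or there is an $I$-large $\mathcal M$-cardinal $\theta$ with $\mathcal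 M\models f(\{x_1,\dots,x_n\})\notin H_\theta$ for all $x_1,\dots,x_n\in X$ (with $\{x_1,\ldots,x_n\}\in[X]^n$). $H_\theta$ is the set of sets whose transitive closure has cardinality $<\theta$. *)

(* Defs.v *)
From mathcomp Require Import all_boot.
From mathcomp Require Import boolp classical_sets cardinality.

Set Implicit Arguments.
Unset Strict Implicit.
Unset Printing Implicit Defensive.

Local Open Scope classical_set_scope.

Record Lstruct := MkLstruct {
  carrier :> Type;
  mem_in : carrier -> carrier -> Prop }.

Declare Scope lset_scope.
Delimit Scope lset_scope with L.
Notation "x ∈ y" := (mem_in x y) (at level 70, no associativity) : lset_scope.
Local Open Scope lset_scope.

Definition substr (M : Lstruct) (I : set M) : Lstruct :=
  MkLstruct (fun x y : {x : M | I x} => proj1_sig x ∈ proj1_sig y).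

(* De Bruijn indices: every quantifier binds index 0 of its body, while the
   bound [j] of a bounded quantifier refers to the outer context, so that the
   bound variable never occurs in its own bound. *)
Inductive form : Type :=
| Feq (i j : nat)
| Fmem (i j : nat)
| Fneg (p : form)
| Fand (p q : form)
| For (p q : form)
| Fimp (p q : form)
| Fall_in (j : nat) (p : form)
| Fex_in (j : nat) (p : form)
| Fall_sub (j : nat) (p : form)
| Fex_sub (j : nat) (p : form)
| Fall (p : form)
| Fex (p : form).

Fixpoint delta0P (p : form) : bool :=
  match p with
  | Feq _ _ | Fmem _ _ => true
  | Fneg p => delta0P p
  | Fand p q | For p q | Fimp p q => delta0P p && delta0P q
  | Fall_in _ p | Fex_in _ p | Fall_sub _ p | Fex_sub _ p => delta0P p
  | Fall _ | Fex _ => false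
  end.

Fixpoint delta0 (p : form) : bool :=
  match p with
  | Feq _ _ | Fmem _ _ => true
  | Fneg p => delta0 p
  | Fand p q | For p q | Fimp p q => delta0 p && delta0 q
  | Fall_in _ p | Fex_in _ p => delta0 p
  | Fall_sub _ _ | Fex_sub _ _ | Fall _ | Fex _ => false
  end.

Fixpoint sigma1 (p : form) : bool :=
  if p is Fex q then sigma1 q else delta0 p.

Definition scons (T : Type) (x : T) (e : nat -> T) : nat -> T :=
  fun n => if n is m.+1 then e m else x.

Section Structure.
Variable M : Lstruct.
Implicit Types (a b c f p r s t u v w x y z theta kappa : M).

Definition subset_in x y : Prop := forall z, z ∈ x -> z ∈ y.
Local Notation "x ⊆ y" := (subset_in x y) (at level 70, no associativity).

Fixpoint sat (e : nat -> M) (p : form) : Prop :=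
  match p with
  | Feq i j => e i = e j
  | Fmem i j => e i ∈ e j
  | Fneg p => ~ sat e p
  | Fand p q => sat e p /\ sat e q
  | For p q => sat e p \/ sat e q
  | Fimp p q => sat e p -> sat e q
  | Fall_in j p => forall x, x ∈ e j -> sat (scons x e) p
  | Fex_in j p => exists x, x ∈ e j /\ sat (scons x e) p
  | Fall_sub j p => forall x, x ⊆ e j -> sat (scons x e) p
  | Fex_sub j p => exists x, x ⊆ e j /\ sat (scons x e) p
  | Fall p => forall x, sat (scons x e) p
  | Fex p => exists x, sat (scons x e) p
  end.

(* The environment [e] supplies the parameters. *)
Definition separation (C : form -> bool) : Prop :=
  forall (p : form) (e : nat -> M) a, C p ->
    exists b, forall x, x ∈ b <-> x ∈ a /\ sat (scons x e) p.

Definition collection (C : form -> bool) : Prop :=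
  forall (p : form) (e : nat -> M) a, C p ->
    (forall x, x ∈ a -> exists y, sat (scons y (scons x e)) p) ->
    exists b, forall x, x ∈ a -> exists y, y ∈ b /\ sat (scons y (scons x e)) p.

Definition star a : set M := [set x | x ∈ a].

Definition is_empty x : Prop := forall z, ~ z ∈ x.
Definition is_upair p x y : Prop := forall z, z ∈ p <-> z = x \/ z = y.
(* Kuratowski pairs *)
Definition is_opair p x y : Prop :=
  exists u v, [/\ is_upair u x x, is_upair v x y & is_upair p u v].
Definition is_succ y x : Prop := forall z, z ∈ y <-> z ∈ x \/ z = x.
Definition is_inter z x y : Prop := forall w, w ∈ z <-> w ∈ x /\ w ∈ y.
Definition is_diff z x y : Prop := forall w, w ∈ z <-> w ∈ x /\ ~ w ∈ y.

Definition transitive_set x : Prop := forall y, y ∈ x -> y ⊆ x.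

Definition is_TC t x : Prop :=
  [/\ transitive_set t, x ⊆ t
    & forall u, transitive_set u -> x ⊆ u -> t ⊆ u].

(* Linearly ordered by membership suffices: well-foundedness comes from the
   axiom of set foundation. *)
Definition is_ord x : Prop :=
  transitive_set x /\
  forall y z, y ∈ x -> z ∈ x -> [\/ y ∈ z, y = z | z ∈ y].

Definition Ord : set M := [set x | is_ord x].

Definition is_limit x : Prop :=
  [/\ is_ord x, ~ is_empty x & forall y, y ∈ x -> exists z, z ∈ x /\ y ∈ z].

Definition is_omega x : Prop := is_limit x /\ forall y, y ∈ x -> ~ is_limit y.

Definition app f x y : Prop := exists p, is_opair p x y /\ p ∈ f.

Definition is_function_on f (D : set M) : Prop :=
  [/\ forall p, p ∈ f -> exists x y, is_opair p x y,
      forall x y z, app f x y -> app f x z -> y = z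
    & forall x, (exists y, app f x y) <-> D x].

Definition maps_to f (D : set M) b : Prop :=
  is_function_on f D /\ forall x y, app f x y -> y ∈ b.

Definition is_bijection f a b : Prop :=
  [/\ maps_to f (star a) b,
      forall x y z, app f x z -> app f y z -> x = y
    & forall y, y ∈ b -> exists x, app f x y].

Definition is_wellorder r a : Prop :=
  [/\ forall p, p ∈ r -> exists x y, [/\ is_opair p x y, x ∈ a & y ∈ a],
      forall x, ~ app r x x,
      forall x y z, app r x y -> app r y z -> app r x z,
      forall x y, x ∈ a -> y ∈ a -> [\/ app r x y, x = y | app r y x]
    & forall b, b ⊆ a -> ~ is_empty b ->
        exists x, x ∈ b /\ forall y, y ∈ b -> ~ app r y x].

Definition is_cardinal x : Prop :=
  is_ord x /\ forall y, y ∈ x -> ~ exists f, is_bijection f x y.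

Definition has_card x l : Prop :=
  is_cardinal l /\ exists f, is_bijection f x l.

Definition is_regular_cardinal kappa : Prop :=
  [/\ is_cardinal kappa,
      exists w, is_omega w /\ w ⊆ kappa
    & forall a f, a ∈ kappa -> maps_to f (star a) kappa ->
        exists b, b ∈ kappa /\ forall x y, app f x y -> y ∈ b].

Definition Hset theta : set M :=
  [set x | exists t l, [/\ is_TC t x, has_card t l & l ∈ theta]].

Record Mac : Prop := {
  Mac_extensionality : forall x y, (forall z, z ∈ x <-> z ∈ y) -> x = y;
  Mac_pairing : forall x y, exists p, is_upair p x y;
  Mac_emptyset : exists x, is_empty x;
  Mac_union : forall x, exists u, forall z, z ∈ u <-> exists y, y ∈ x /\ z ∈ y;
  Mac_infinity : exists x,
    (exists y, is_empty y /\ y ∈ x) /\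
    (forall y, y ∈ x -> exists z, is_succ z y /\ z ∈ x);
  Mac_powerset : forall x, exists y, forall z, z ∈ y <-> z ⊆ x;
  Mac_transitive_containment : forall x, exists y, transitive_set y /\ x ⊆ y;
  Mac_separation : separation delta0;
  Mac_foundation : forall x, ~ is_empty x ->
    exists y, y ∈ x /\ forall z, z ∈ y -> ~ z ∈ x;
  Mac_wellordering : forall x, exists r, is_wellorder r x }.

Record MOST : Prop := {
  MOST_Mac : Mac;
  MOST_separation : separation sigma1;
  MOST_collection : collection delta0 }.

Definition enumerates (n : nat) (xs : 'I_n -> M) s : Prop :=
  forall z, z ∈ s <-> exists i, z = xs i.

(* the n-element subsets of [x], for a standard [n] *)
Definition nsubsets (n : nat) x : set M :=
  [set s | exists xs : 'I_n -> M,
     [/\ injective xs, forall i, xs i ∈ x & enumerates xs s]].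

Definition constant_on f (D : set M) : Prop :=
  forall s t u v, D s -> D t -> app f s u -> app f t v -> u = v.

Definition increasing_in (n : nat) x (xs : 'I_n -> M) : Prop :=
  (forall i, xs i ∈ x) /\ (forall i j : 'I_n, (i < j)%N -> xs i ∈ xs j).

Definition is_canonical (n : nat) f x : Prop :=
  exists D : {set 'I_n},
    forall ss ts : 'I_n -> M,
      increasing_in x ss -> increasing_in x ts ->
      forall s t u v, enumerates ss s -> enumerates ts t ->
        app f s u -> app f t v ->
        (u = v <-> forall i, i \in D -> ss i = ts i).

End Structure.

Notation "x ⊆ y" := (subset_in x y) (at level 70, no associativity) : lset_scope.

Section Cut.
Variables (M : Lstruct) (I : set M).

Definition Ord_sub : set M :=
  [set x | exists hx : I x, Ord (exist _ x hx : substr I)].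

Definition end_extension : Prop := forall x y : M, I y -> x ∈ y -> I x.

Definition powerset_preserving : Prop :=
  end_extension /\ forall x y : M, I y -> x ⊆ y -> I x.

Definition topless : Prop :=
  [/\ end_extension, I <> setT
    & forall c : M, star c `<=` Ord_sub -> I c].

Definition H_cut : Prop := [/\ topless, powerset_preserving & MOST (substr I)].

Definition I_large (theta : M) : Prop := is_cardinal theta /\ ~ I theta.

Definition downward_cofinal (A B : set M) : Prop :=
  A `<=` B /\ forall b, B b -> exists a, A a /\ (a ∈ b \/ a = b).

Variables (kappa : M) (U : set M).

Definition is_ultrafilter : Prop :=
  [/\ forall x, U x -> x ⊆ kappa,
      U kappa /\ (forall x, is_empty x -> ~ U x),
      forall x y, U x -> x ⊆ y -> y ⊆ kappa -> U y,
      forall x y z, U x -> U y -> is_inter z x y -> U z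
    & forall x y, x ⊆ kappa -> is_diff y kappa x -> U x \/ U y].

Definition nonprincipal : Prop :=
  ~ exists a, a ∈ kappa /\ forall x, U x <-> x ⊆ kappa /\ a ∈ x.

Definition I_complete : Prop :=
  forall (n : nat) (f a t : M), I a -> is_TC t a ->
    maps_to f (nsubsets n kappa) t ->
    exists x, U x /\ constant_on f (nsubsets n x).

Definition canonically_Ramsey : Prop :=
  forall (n : nat) (f : M), is_function_on f (nsubsets n kappa) ->
    exists x, U x /\ is_canonical n f x.

Definition I_tight : Prop :=
  forall (n : nat) (f : M), is_function_on f (nsubsets n kappa) ->
    exists x, U x /\
      (constant_on f (nsubsets n x) \/
       exists theta, I_large theta /\
         forall s v, nsubsets n x s -> app f s v -> ~ Hset theta v).

Definition cards_of : set M := [set l | exists x, U x /\ has_card x l].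

End Cut.

(* Main.v *)
Require Import Defs.
From mathcomp Require Import all_boot.
From mathcomp Require Import boolp classical_sets cardinality.
From mathcomp Require Import zify.

Set Implicit Arguments.
Unset Strict Implicit.
Unset Printing Implicit Defensive.

Local Open Scope classical_set_scope.
Local Open Scope lset_scope.

(* Call a set of M "small" if some element of I is mapped onto it inside M.  The
   ordinals of M outside I are not small (Hartogs' argument, carried out in I),
   and since the cut is topless, an internal property that holds of every ordinal
   of I holds of some ordinal below kappa outside I ("overspill").  Both together
   give partition theorems that lead from non-small sets to non-small sets, with
   no cardinal arithmetic: in the Erdos-Rado tree of a colouring of a non-small
   set X, if every branch embedded into one ordinal of I, then X would be covered
   by a set of codes in I; so every ordinal of I embeds into a branch, and by
   overspill some branch is not small.  This yields Ramsey's theorem for the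
   standard exponents, and, applied to the patterns of equality between the values
   of f, canonical sets.  On a canonical set the fibres over a small set of values
   are removable, which gives completeness and, by one more overspill, tightness.
   As M is countable, all requirements are met along a decreasing omega-sequence
   of non-small sets, which generates the ultrafilter. *)

(** * Definability *)

(** Two obstacles shape the development. Smallness is external, since it quantifies over [I], so
    [overspill] cannot be applied to it. It is applied instead to the internal statement that the
    ordinal [al] injects into a certain set: this holds for every [al] in [I], and an instance
    outside [I] makes the set non-small by Hartogs. Moreover, the arguments inside [M] rest on
    Delta_0 separation, so a predicate that is to be separated or overspilled must have all its
    quantifiers bounded by sets formed beforehand. Hence the bounds such as [pw (prod k k)], and the
    definability calculus [Dfn], which replaces writing formulas by hand. The exponent [n] is
    standard: tuples are external functions on ['I_n], and a quantifier over them unfolds into [n]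
    bounded ones. *)

Definition up (r : nat -> nat) (i : nat) : nat := if i is j.+1 then (r j).+1 else 0.

Fixpoint ren (r : nat -> nat) (p : form) : form :=
  match p with
  | Feq i j => Feq (r i) (r j)
  | Fmem i j => Fmem (r i) (r j)
  | Fneg p => Fneg (ren r p)
  | Fand p q => Fand (ren r p) (ren r q)
  | For p q => For (ren r p) (ren r q)
  | Fimp p q => Fimp (ren r p) (ren r q)
  | Fall_in j p => Fall_in (r j) (ren (up r) p)
  | Fex_in j p => Fex_in (r j) (ren (up r) p)
  | Fall_sub j p => Fall_sub (r j) (ren (up r) p)
  | Fex_sub j p => Fex_sub (r j) (ren (up r) p)
  | Fall p => Fall (ren (up r) p)
  | Fex p => Fex (ren (up r) p)
  end.

Lemma delta0_ren p r : delta0 (ren r p) = delta0 p.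
Proof.
by elim: p r => //= [p IHp q IHq|p IHp q IHq|p IHp q IHq] r; rewrite IHp IHq.
Qed.

Lemma scons_up (T : Type) (x : T) e r :
  (fun i => scons x e (up r i)) = scons x (fun i => e (r i)).
Proof. by apply: funext => -[|i]. Qed.

Lemma sat_ren (M : Lstruct) p r (e : nat -> M) :
  sat e (ren r p) = sat (fun i => e (r i)) p.
Proof.
elim: p r e => //=; try by move=> p IHp r e; rewrite IHp.
- by move=> p IHp q IHq r e; rewrite IHp IHq.
- by move=> p IHp q IHq r e; rewrite IHp IHq.
- by move=> p IHp q IHq r e; rewrite IHp IHq.
- by move=> j p IHp r e; apply: eq_forall => x; rewrite IHp scons_up.
- by move=> j p IHp r e; apply: eq_exists => x; rewrite IHp scons_up.
- by move=> j p IHp r e; apply: eq_forall => x; rewrite IHp scons_up.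
- by move=> j p IHp r e; apply: eq_exists => x; rewrite IHp scons_up.
- by move=> p IHp r e; apply: eq_forall => x; rewrite IHp scons_up.
- by move=> p IHp r e; apply: eq_exists => x; rewrite IHp scons_up.
Qed.

Lemma iff_of_eq (P Q : Prop) : P = Q -> (P <-> Q).
Proof. by move->. Qed.

Section Definability.
Variables (M : Lstruct) (K : set M).

Definition term (t : (nat -> M) -> M) : Prop :=
  (exists i, t = fun e => e i) \/ (exists c, K c /\ t = fun=> c).

(* [Dfn P]: the predicate [P] on environments is defined by a Delta_0 formula
   with constants in [K].  The binder rules below are stated so that they apply
   by second-order unification: the freshly bound variable is [e 0], and the
   enclosing environment is the tail [fun n => e n.+1]. *)
Definition Dfn (P : (nat -> M) -> Prop) : Prop :=
  exists (p : form) (ts : nat -> (nat -> M) -> M),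
    [/\ delta0 p, forall i, term (ts i)
      & forall e, sat (fun i => ts i e) p <-> P e].

Lemma term_var i : term (fun e => e i).
Proof. by left; exists i. Qed.

Lemma term_const c : K c -> term (fun=> c).
Proof. by right; exists c. Qed.

Lemma Dfn_ext P Q : (forall e, P e <-> Q e) -> Dfn P -> Dfn Q.
Proof.
by move=> PQ [p [ts [p0 tts h]]]; exists p, ts; split=> // e; rewrite h.
Qed.

Lemma Dfn_mem s t : term s -> term t -> Dfn (fun e => s e ∈ t e).
Proof.
move=> hs ht; exists (Fmem 0 1), (fun i => if i is 0 then s else t).
by split=> // -[].
Qed.

Lemma Dfn_eq s t : term s -> term t -> Dfn (fun e => s e = t e).
Proof.
move=> hs ht; exists (Feq 0 1), (fun i => if i is 0 then s else t).
by split=> // -[].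
Qed.

Lemma Dfn_not P : Dfn P -> Dfn (fun e => ~ P e).
Proof.
by move=> [p [ts [p0 tts h]]]; exists (Fneg p), ts; split=> // e /=; rewrite h.
Qed.

(** Two definitions are brought onto one list of terms by interleaving: even indices carry the terms
    of [P], odd ones those of [Q]. *)
Lemma Dfn_pair P Q : Dfn P -> Dfn Q -> exists p q ts,
  [/\ delta0 p, delta0 q, forall i, term (ts i),
      forall e, sat (fun i => ts i e) p <-> P e
    & forall e, sat (fun i => ts i e) q <-> Q e].
Proof.
move=> [p [ts [p0 tts hp]]] [q [us [q0 tus hq]]].
exists (ren (fun i => i.*2) p), (ren (fun i => i.*2.+1) q).
exists (fun i => if odd i then us i./2 else ts i./2).
rewrite !delta0_ren; split=> // [i|e|e]; first by case: odd.
- rewrite sat_ren -hp; apply: iff_of_eq; congr (sat _ p).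
  by apply: funext => i; rewrite odd_double doubleK.
- rewrite sat_ren -hq; apply: iff_of_eq; congr (sat _ q).
  by apply: funext => i /=; rewrite odd_double /= uphalf_double.
Qed.

Lemma Dfn_and P Q : Dfn P -> Dfn Q -> Dfn (fun e => P e /\ Q e).
Proof.
move=> /Dfn_pair h /h [p [q [ts [p0 q0 tts hp hq]]]].
by exists (Fand p q), ts; rewrite /= p0; split=> // e; rewrite hp hq.
Qed.

Lemma Dfn_or P Q : Dfn P -> Dfn Q -> Dfn (fun e => P e \/ Q e).
Proof.
move=> /Dfn_pair h /h [p [q [ts [p0 q0 tts hp hq]]]].
by exists (For p q), ts; rewrite /= p0; split=> // e; rewrite hp hq.
Qed.

Lemma Dfn_imp P Q : Dfn P -> Dfn Q -> Dfn (fun e => P e -> Q e).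
Proof.
move=> /Dfn_pair h /h [p [q [ts [p0 q0 tts hp hq]]]].
by exists (Fimp p q), ts; rewrite /= p0; split=> // e; rewrite hp hq.
Qed.

Lemma Dfn_iff P Q : Dfn P -> Dfn Q -> Dfn (fun e => P e <-> Q e).
Proof. by move=> hP hQ; apply: Dfn_and; apply: Dfn_imp. Qed.

(** An informative disjunction, because the renamings in the binder lemmas are computed from it. *)
Lemma term_case t : term t ->
  {u | term u & forall e x, t (scons x e) = u e} + {t = fun e => e 0}.
Proof.
move=> ht; case: (pselect (t = fun e => e 0)) => [->|ne]; [by right|left].
apply: cid2; case: ht => [[[|j] tj]|[c [Kc tc]]] //.
- by exists (fun e => e j) => [|e x]; [exact: term_var|rewrite tj].
- by exists (fun=> c) => [|e x]; [exact: term_const|rewrite tc].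
Qed.

(** Several terms of the list may equal the bound variable. The renaming sends all of them to index
    0, and the other terms are read in the outer environment. *)
Lemma Dfn_binder (P : (nat -> M) -> M -> Prop) :
  Dfn (fun e => P (fun n => e n.+1) (e 0)) ->
  exists q us, [/\ delta0 q, forall i, term (us i)
    & forall e x, sat (scons x (fun i => us i e)) q <-> P e x].
Proof.
move=> [p [ts [p0 tts hp]]]; pose v i := term_case (tts i).
pose r i := if v i is inleft _ then i.+1 else 0.
(* The renamed formula never reads the positions whose term was the bound variable, so they receive
   an arbitrary term. *)
exists (ren r p), (fun i => if v i is inleft u then s2val u else fun e => e 0).
rewrite delta0_ren; split=> // [i|e x].
  by case: (v i) => [[u]|_] //=; exact: term_var.
rewrite sat_ren; have /= := hp (scons x e).
set a := sat _ _; set b := sat _ _; suff -> : b = a by [].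
rewrite /a /b; congr (sat _ p); apply: funext => i; rewrite /r.
by case E: (v i) => [[u tu hu]|ti] /=; [rewrite E hu|rewrite ti].
Qed.

Lemma Dfn_binder2 (P : (nat -> M) -> M -> M -> Prop) :
  Dfn (fun e => P (fun n => e n.+2) (e 1) (e 0)) ->
  exists q us, [/\ delta0 q, forall i, term (us i)
    & forall e x y, sat (scons y (scons x (fun i => us i e))) q <-> P e x y].
Proof.
move=> /(@Dfn_binder (fun e y => P (fun n => e n.+1) (e 0) y))[p [ts [p0 tts hp]]].
pose v i := term_case (tts i).
pose r i := if i is j.+1 then if v j is inleft _ then j.+2 else 1 else 0.
exists (ren r p), (fun i => if v i is inleft u then s2val u else fun e => e 0).
rewrite delta0_ren; split=> // [i|e x y].
  by case: (v i) => [[u]|_] //=; exact: term_var.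
rewrite sat_ren; have /= := hp (scons x e) y.
set a := sat _ _; set b := sat _ _; suff -> : b = a by [].
rewrite /a /b; congr (sat _ p); apply: funext => -[|i] //=.
by case E: (v i) => [[u tu hu]|ti] /=; [rewrite E hu|rewrite ti].
Qed.

Lemma Dfn_all_in t P : term t -> Dfn (fun e => P (fun n => e n.+1) (e 0)) ->
  Dfn (fun e => forall x, x ∈ t e -> P e x).
Proof.
move=> tt /(@Dfn_binder P)[q [us [q0 tus h]]].
(* Index 0 of the new list holds the bound [t], so under the binder the outer indices of the body
   shift by one. *)
exists (Fall_in 0 (ren (up S) q)), (fun i => if i is j.+1 then us j else t).
rewrite /= delta0_ren; split=> // [[]//|e].
by apply: iff_of_eq; apply/eq_forall => x; rewrite sat_ren scons_up propeqE h.
Qed.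

Lemma Dfn_ex_in t P : term t -> Dfn (fun e => P (fun n => e n.+1) (e 0)) ->
  Dfn (fun e => exists x, x ∈ t e /\ P e x).
Proof.
move=> tt /(@Dfn_binder P)[q [us [q0 tus h]]].
exists (Fex_in 0 (ren (up S) q)), (fun i => if i is j.+1 then us j else t).
rewrite /= delta0_ren; split=> // [[]//|e].
by apply: iff_of_eq; apply/eq_exists => x; rewrite sat_ren scons_up propeqE h.
Qed.

Lemma term_ren t r : term t -> term (fun e => t (fun n => e (r n))).
Proof.
by case=> [[i ->]|[c [Kc ->]]]; [exact: term_var|exact: term_const].
Qed.

(** Decided classically outside [M]; this lets external side conditions such as [i < j] occur in
    definable predicates. *)
Lemma Dfn_prop (Q : Prop) : Dfn (fun=> Q).
Proof.
have T := Dfn_eq (term_var 0) (term_var 0).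
case: (pselect Q) => q; first by apply: Dfn_ext T.
by apply: Dfn_ext (Dfn_not T) => e; split.
Qed.

Lemma Dfn_all_ord n (P : 'I_n -> (nat -> M) -> Prop) :
  (forall i, Dfn (P i)) -> Dfn (fun e => forall i, P i e).
Proof.
move=> hP.
suff h (l : seq 'I_n) : Dfn (fun e => forall i, i \in l -> P i e).
  by apply: Dfn_ext (h (enum 'I_n)) => e; split=> h' i *; apply: h'; rewrite ?mem_enum.
elim: l => [|j l IHl]; first by apply: Dfn_ext (Dfn_prop True) => e; split.
apply: Dfn_ext (Dfn_and (hP j) IHl) => e; split=> [[hj hl] i|h].
  by rewrite inE => /orP[/eqP->//|/hl].
by split=> [|i il]; apply: h; rewrite inE ?eqxx // il orbT.
Qed.

Lemma Dfn_ex_ord n (P : 'I_n -> (nat -> M) -> Prop) :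
  (forall i, Dfn (P i)) -> Dfn (fun e => exists i, P i e).
Proof.
move=> hP; have hN i : Dfn (fun e => ~ P i e) by exact: Dfn_not.
apply: Dfn_ext (Dfn_not (Dfn_all_ord hN)) => e; split.
  by move=> /existsNP[i /contrapT]; exists i.
by move=> [i Pi] /(_ i).
Qed.

Definition consf (T : Type) n (x : T) (ws : 'I_n -> T) (i : 'I_n.+1) : T :=
  if unlift ord0 i is Some j then ws j else x.

Lemma consf_eta (T : Type) n (ws : 'I_n.+1 -> T) :
  consf (ws ord0) (fun j => ws (lift ord0 j)) = ws.
Proof. by apply: funext => i; rewrite /consf; case: unliftP => [j|] ->. Qed.

(** The hypothesis ranges over renamings and terms because the induction passes under [n] binders,
    each of which shifts the environment and makes one component of the tuple a variable. *)
Lemma Dfn_ex_tuple n t (P : (nat -> M) -> ('I_n -> M) -> Prop) : term t ->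
  (forall r (ts : 'I_n -> (nat -> M) -> M), (forall i, term (ts i)) ->
     Dfn (fun e => P (fun j => e (r j)) (fun i => ts i e))) ->
  Dfn (fun e => exists ws : 'I_n -> M, (forall i, ws i ∈ t e) /\ P e ws).
Proof.
elim: n t P => [|n IHn] t P tt hP.
  apply: Dfn_ext (hP id (fun=> fun e => e 0) _) => [e|i]; last exact: term_var.
  split=> [h|[ws [_ h]]]; first by exists (fun=> e 0); split=> // -[].
  by rewrite (_ : (fun _ => _) = ws) //; apply: funext => -[].
apply: (@Dfn_ext (fun e => exists x, x ∈ t e /\
    exists ws : 'I_n -> M, (forall i, ws i ∈ t e) /\ P e (consf x ws))) => [e|].
  split=> [[x [xt [ws [wst h]]]]|[ws [wst h]]].
    by exists (consf x ws); split=> // i; rewrite /consf; case: unlift.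
  exists (ws ord0); split=> //; exists (fun j => ws (lift ord0 j)).
  by rewrite consf_eta.
apply: Dfn_ex_in => //.
apply: (IHn (fun e => t (fun n => e n.+1))
            (fun e ws => P (fun n => e n.+1) (consf (e 0) ws))).
  exact: term_ren.
move=> r ts tts.
apply: Dfn_ext (hP (fun j => r j.+1) (fun i => consf (fun e => e (r 0)) ts i) _) => [e|i].
  apply: iff_of_eq; congr P; apply: funext => i; rewrite /consf.
  by case: unlift.
by rewrite /consf; case: unlift => // ; exact: term_var.
Qed.

Lemma Dfn_sub s t : term s -> term t -> Dfn (fun e => s e ⊆ t e).
Proof.
move=> hs ht; apply: Dfn_all_in => //.
by apply: Dfn_mem; [exact: term_var|exact: term_ren].
Qed.

Lemma Dfn_upair p s t : term p -> term s -> term t ->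
  Dfn (fun e => is_upair (p e) (s e) (t e)).
Proof.
move=> hp hs ht.
apply: (@Dfn_ext (fun e => (forall z, z ∈ p e -> z = s e \/ z = t e)
                           /\ (s e ∈ p e /\ t e ∈ p e))); last first.
  apply: Dfn_and; last by apply: Dfn_and; apply: Dfn_mem.
  apply: Dfn_all_in => //.
  by apply: Dfn_or; apply: Dfn_eq; by [exact: term_var|exact: term_ren].
move=> e; split=> [[h [hs' ht']] z|h].
  by split=> [/h//|[->|->]].
by split=> [z /h//|]; split; apply/h; [left|right].
Qed.

Lemma Dfn_opair p s t : term p -> term s -> term t ->
  Dfn (fun e => is_opair (p e) (s e) (t e)).
Proof.
move=> hp hs ht.
apply: (@Dfn_ext (fun e => exists u, u ∈ p e /\ exists v, v ∈ p e /\
   (is_upair u (s e) (s e) /\ (is_upair v (s e) (t e) /\ is_upair (p e) u v)))).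
  move=> e; split=> [[u [_ [v [_ [h1 [h2 h3]]]]]]|[u [v [h1 h2 h3]]]].
    by exists u, v.
  by exists u; split; [apply/h3; left|exists v; split; [apply/h3; right|]].
apply: Dfn_ex_in => //; apply: Dfn_ex_in; first exact: term_ren.
by do !apply: Dfn_and; apply: Dfn_upair; by [exact: term_var|exact: term_ren].
Qed.

End Definability.

Ltac dterm := solve
  [ exact: term_var | apply: term_const; done | done
  | apply: term_ren; done | auto ].

Ltac dfn_step := first
  [ apply: Dfn_not | apply: Dfn_all_in; first dterm | apply: Dfn_ex_in; first dterm
  | apply: Dfn_iff | apply: Dfn_and | apply: Dfn_or | apply: Dfn_imp
  | apply: Dfn_eq; dterm | apply: Dfn_mem; dterm | apply: Dfn_sub; dterm
  | apply: Dfn_upair; dterm | apply: Dfn_opair; dterm ].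

(** * Set theory in [M]: pairs, ordinals, recursion, cardinals *)

Section SetTheory.
Variable M : Lstruct.
Hypothesis HM : Mac M.
Implicit Types (a b c d f g h p r s t u v w x y z : M).

Local Notation D := (Dfn (@setT M)).

(** Makes the operations of set theory total functions on [M]; the default [x] is never reached
    where the axioms provide a witness. *)
Definition pick (x : M) (P : M -> Prop) : M :=
  if pselect (exists y, P y) is left e then sval (cid e) else x.

Lemma pickP x P : (exists y, P y) -> P (pick x P).
Proof. by rewrite /pick; case: pselect => // e _; case: cid. Qed.

Lemma ext x y : (forall z, z ∈ x <-> z ∈ y) -> x = y.
Proof. exact: Mac_extensionality. Qed.

Definition pr x y : M := pick x (fun p => is_upair p x y).
Definition un x : M := pick x (fun u => forall z, z ∈ u <-> exists y, y ∈ x /\ z ∈ y).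
Definition pw x : M := pick x (fun y => forall z, z ∈ y <-> z ⊆ x).
Definition op x y : M := pr (pr x x) (pr x y).
Definition cup x y : M := un (pr x y).

Lemma in_pr x y z : z ∈ pr x y <-> z = x \/ z = y.
Proof. exact: (pickP x (Mac_pairing HM x y)). Qed.

Lemma in_un x z : z ∈ un x <-> exists y, y ∈ x /\ z ∈ y.
Proof. exact: (pickP x (Mac_union HM x)). Qed.

Lemma in_pw x z : z ∈ pw x <-> z ⊆ x.
Proof. exact: (pickP x (Mac_powerset HM x)). Qed.

Lemma in_cup x y z : z ∈ cup x y <-> z ∈ x \/ z ∈ y.
Proof.
rewrite in_un; split=> [[w [/in_pr[->|->] zw]]|]; [by left|by right|].
by case=> zw; [exists x|exists y]; split=> //; apply/in_pr; [left|right].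
Qed.

Lemma upairE p x y : is_upair p x y <-> p = pr x y.
Proof.
split=> [h|-> z]; last exact: in_pr.
by apply: ext => z; rewrite in_pr; apply: h.
Qed.

Lemma opairE p x y : is_opair p x y <-> p = op x y.
Proof.
split=> [[u [v [/upairE-> /upairE-> /upairE->]]]//|->].
by exists (pr x x), (pr x y); split; apply/upairE.
Qed.

Lemma appE f x y : app f x y <-> op x y ∈ f.
Proof.
split=> [[p [/opairE->]]//|h].
by exists (op x y); split=> //; apply/opairE.
Qed.

Lemma pr_inj x y u v : pr x y = pr u v -> (x = u /\ y = v) \/ (x = v /\ y = u).
Proof.
move=> E.
have h z : (z = x \/ z = y) <-> (z = u \/ z = v) by rewrite -!in_pr E.
have [hx hy] : (x = u \/ x = v) /\ (y = u \/ y = v).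
  by split; apply/h; [left|right].
have [hu hv] : (u = x \/ u = y) /\ (v = x \/ v = y).
  by split; apply/h; [left|right].
case: hx => xE; case: hy => yE; [left|by left|by right|right].
- by split=> //; case: hv => vE; congruence.
- by split=> //; case: hu => uE; congruence.
Qed.

Lemma op_inj x y u v : op x y = op u v -> x = u /\ y = v.
Proof.
by move=> /pr_inj[[/pr_inj h1 /pr_inj h2]|[/pr_inj h1 /pr_inj h2]];
  intuition congruence.
Qed.

(** A pair [op x y] is not a [term], so its membership in [g] is expressed by a quantifier over the
    elements of [g]. *)
Lemma Dfn_op (K : set M) (g s t : (nat -> M) -> M) : term K g -> term K s -> term K t ->
  Dfn K (fun e => op (s e) (t e) ∈ g e).
Proof.
move=> hg hs ht.
apply: (@Dfn_ext _ _ (fun e => exists p, p ∈ g e /\ is_opair p (s e) (t e))).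
  by move=> e; rewrite -appE; split=> -[p []]; exists p.
by do !dfn_step.
Qed.

Lemma Dfn_eqop (K : set M) (p s t : (nat -> M) -> M) : term K p -> term K s -> term K t ->
  Dfn K (fun e => p e = op (s e) (t e)).
Proof.
move=> hp hs ht; apply: (@Dfn_ext _ _ (fun e => is_opair (p e) (s e) (t e))).
  by move=> e; exact: opairE.
by do !dfn_step.
Qed.

Ltac dfn := do !(first [apply: Dfn_op; dterm | apply: Dfn_eqop; dterm | dfn_step]).

Lemma sepP a (P : M -> Prop) : D (fun e => P (e 0)) ->
  exists b, forall x, x ∈ b <-> x ∈ a /\ P x.
Proof.
move=> /(@Dfn_binder _ _ (fun=> P))[q [us [q0 tus h]]].
have [b bP] := Mac_separation HM (fun i => us i (fun=> a)) a q0.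
by exists b => x; rewrite bP h.
Qed.

Lemma prodP a b : exists c, forall p,
  p ∈ c <-> exists x y, [/\ x ∈ a, y ∈ b & p = op x y].
Proof.
have [|c cP] := @sepP (pw (pw (cup a b)))
  (fun p => exists x, x ∈ a /\ exists y, y ∈ b /\ p = op x y).
  by dfn.
exists c => p; rewrite cP; split=> [[_ [x [xa [y [yb ->]]]]]|[x [y [xa yb ->]]]].
  by exists x, y.
split; last by exists x; split=> //; exists y.
by apply/in_pw => u /in_pr[]->; apply/in_pw => z /in_pr[]->; apply/in_cup; by [left|right].
Qed.

Definition prod a b : M :=
  pick a (fun c => forall p, p ∈ c <-> exists x y, [/\ x ∈ a, y ∈ b & p = op x y]).

Lemma in_prod a b p : p ∈ prod a b <-> exists x y, [/\ x ∈ a, y ∈ b & p = op x y].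
Proof. exact: (pickP a (prodP a b)). Qed.

Lemma op_prod a b x y : op x y ∈ prod a b <-> x ∈ a /\ y ∈ b.
Proof.
rewrite in_prod; split=> [[u [v [ua vb /op_inj[-> ->]]]]//|[xa yb]].
by exists x, y.
Qed.

Lemma relP a b (R : M -> M -> Prop) : D (fun e => R (e 1) (e 0)) ->
  exists g, g ⊆ prod a b /\ forall x y, op x y ∈ g <-> [/\ x ∈ a, y ∈ b & R x y].
Proof.
move=> hR; have [|g gP] := @sepP (prod a b)
  (fun p => exists x, x ∈ a /\ exists y, y ∈ b /\ (p = op x y /\ R x y)).
  by dfn; exact: hR.
exists g; split=> [p /gP[]//|x y]; rewrite gP op_prod; split.
  by move=> [_ [u [ua [v [vb [/op_inj[-> ->] h]]]]]].
by move=> [xa yb h]; split=> //; exists x; split=> //; exists y.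
Qed.

Lemma found a x (P : M -> Prop) : D (fun e => P (e 0)) -> x ∈ a -> P x ->
  exists y, [/\ y ∈ a, P y & forall z, z ∈ y -> z ∈ a -> ~ P z].
Proof.
move=> /(sepP a)[b bP] xa Px.
have [|y [/bP[ya Py] ymin]] := Mac_foundation HM (x := b).
  by move=> /(_ x); apply; apply/bP.
by exists y; split=> // z zy za Pz; apply: (ymin z zy); apply/bP.
Qed.

Lemma mem_irr x : ~ x ∈ x.
Proof.
move=> xx; have [|y [/in_pr yx ymin]] := Mac_foundation HM (x := pr x x).
  by move=> /(_ x); apply; apply/in_pr; left.
have {}yx : y = x by case: yx.
by apply: (ymin x); rewrite ?yx //; apply/in_pr; left.
Qed.

Lemma mem_asym x y : x ∈ y -> ~ y ∈ x.
Proof.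
move=> xy yx; have [|z [/in_pr zE zmin]] := Mac_foundation HM (x := pr x y).
  by move=> /(_ x); apply; apply/in_pr; left.
case: zE => ?; subst z; first by apply: (zmin y) => //; apply/in_pr; right.
by apply: (zmin x) => //; apply/in_pr; left.
Qed.

Lemma mem_cyc3 x y z : x ∈ y -> y ∈ z -> ~ z ∈ x.
Proof.
move=> xy yz zx.
have [|w [/in_cup wE wmin]] := Mac_foundation HM (x := cup (pr x y) (pr z z)).
  by move=> /(_ x); apply; apply/in_cup; left; apply/in_pr; left.
have wE' : [\/ w = x, w = y | w = z].
  by case: wE => /in_pr[]; [constructor 1|constructor 2|constructor 3|constructor 3].
case: wE' => ?; subst w.
- by apply: (wmin z) => //; apply/in_cup; right; apply/in_pr; left.
- by apply: (wmin x) => //; apply/in_cup; left; apply/in_pr; left.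
- by apply: (wmin y) => //; apply/in_cup; left; apply/in_pr; right.
Qed.

Lemma ord_mem x y : is_ord x -> y ∈ x -> is_ord y.
Proof.
move=> [tx lx] yx; split=> [z zy w wz|z w zy wy].
  have zx := tx _ yx _ zy; have wx := tx _ zx _ wz.
  case: (lx w y wx yx) => // [wy|yw]; last by case: (mem_cyc3 wz zy yw).
  by subst w; case: (mem_asym wz).
by apply: lx; apply: tx yx _ _.
Qed.

Lemma ord_trans x y z : is_ord z -> x ∈ y -> y ∈ z -> x ∈ z.
Proof. by move=> [tz _] xy /tz; apply. Qed.

Lemma ord_sub x y : is_ord x -> transitive_set y -> y ⊆ x -> y = x \/ y ∈ x.
Proof.
move=> ox ty yx.
case: (pselect (x ⊆ y)) => [xy|/existsNP[z /not_implyP[zx zy]]].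
  by left; apply: ext => z; split=> [/yx|/xy].
have [|m [mx my mmin]] := @found x z (fun z => ~ z ∈ y) _ zx zy; first by dfn.
right; suff <- : m = y by [].
have [tx lx] := ox.
apply: ext => w; split=> [wm|wy].
  by apply: contrapT => /(mmin w wm); apply; apply: tx mx _ _.
case: (lx w m (yx _ wy) mx) => // [wm|mw]; first by subst w.
by case: my; apply: ty wy _ _.
Qed.

Lemma ord_lin x y : is_ord x -> is_ord y -> [\/ x ∈ y, x = y | y ∈ x].
Proof.
move=> ox oy; have [|z zP] := @sepP x (fun z => z ∈ y); first by dfn.
have tz : transitive_set z.
  move=> u /zP[ux uy] w wu; apply/zP.
  by split; [apply: (ord_trans ox wu)|apply: (ord_trans oy wu)].
have [zx zy] : z ⊆ x /\ z ⊆ y by split=> u /zP[].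
case: (ord_sub ox tz zx) => [<-|zx'].
  by case: (ord_sub oy tz zy) => [->|]; [constructor 2|constructor 1].
case: (ord_sub oy tz zy) => [<-|zy']; first by constructor 3.
by case: (@mem_irr z); apply/zP.
Qed.

Lemma subset_trans x y z : x ⊆ y -> y ⊆ z -> x ⊆ z.
Proof. by move=> xy yz w /xy/yz. Qed.

Lemma prod_mono a b c d : a ⊆ c -> b ⊆ d -> prod a b ⊆ prod c d.
Proof.
move=> ac bd p /in_prod[x [y [xa yb ->]]].
by apply/op_prod; split; [apply: ac|apply: bd].
Qed.

(** Recursion along membership, confined to [prod A B] so that the approximations range over a power
    set and Delta_0 separation suffices. What is built is a relation: its section at [z] is
    determined by its part over the members of [z]. *)
Lemma recursion (A B : M) (Psi : M -> M -> M -> Prop) :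
  (forall x y z, x ∈ A -> y ∈ x -> z ∈ y -> z ∈ x) ->
  (forall s t u : (nat -> M) -> M, term setT s -> term setT t -> term setT u ->
     D (fun e => Psi (s e) (t e) (u e))) ->
  (forall z v g g', z ∈ A ->
     (forall w u, w ∈ z -> (op w u ∈ g <-> op w u ∈ g')) ->
     Psi z v g -> Psi z v g') ->
  exists F, F ⊆ prod A B /\
    forall z v, z ∈ A -> v ∈ B -> (op z v ∈ F <-> Psi z v F).
Proof.
move=> Atr hD loc.
pose C g x := forall z, z ∈ A -> z ∈ x -> forall v, v ∈ B -> (op z v ∈ g <-> Psi z v g).
have uniq g g' x : g ⊆ prod A B -> g' ⊆ prod A B -> x ∈ A -> C g x -> C g' x ->
    forall w u, w ∈ x -> (op w u ∈ g <-> op w u ∈ g').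
  move=> gAB gAB' xA Cg Cg' w u wx.
  case: (pselect (w ∈ A /\ u ∈ B)) => [[wA uB]|nAB]; last first.
    by split=> [/gAB|/gAB'] /op_prod.
  apply: contrapT => neq.
  have [||z [zA [zx [v [vB nv]]] zmin]] := @found A w
      (fun z => z ∈ x /\ exists v, v ∈ B /\ ~ (op z v ∈ g <-> op z v ∈ g')) _ wA.
  - by dfn.
  - by split=> //; exists u.
  apply: nv; rewrite (Cg z zA zx v vB) (Cg' z zA zx v vB).
  have agree w' u' : w' ∈ z -> (op w' u' ∈ g <-> op w' u' ∈ g').
    move=> wz; case: (pselect (w' ∈ A /\ u' ∈ B)) => [[wA' uB']|nAB]; last first.
      by split=> [/gAB|/gAB'] /op_prod.
    apply: contrapT => neq'; apply: (zmin w') => //.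
    by split; [exact: Atr xA zx wz|exists u'].
  split; first exact: loc zA agree.
  by apply: loc => // w' u' wz; split=> /(agree w' u' wz).
(* [F] is read off at [z] from any approximation correct below [z]. By [uniq] the choice does not
   matter, and below a least failure [F] is itself such an approximation. *)
have [|F [FAB FP]] := @relP A B (fun z v =>
    exists g, g ∈ pw (prod A B) /\ (C g z /\ Psi z v g)).
  by rewrite /C; dfn; try (apply: hD; dterm).
exists F; split=> // z0 v0 zA0 vB0; apply: contrapT => neq.
have [||z [zA [v [vB nv]] zmin]] := @found A z0
    (fun z => exists v, v ∈ B /\ ~ (op z v ∈ F <-> Psi z v F)) _ zA0.
- by dfn; apply: hD; dterm.
- by exists v0.
have CF : C F z.
  move=> w wA wz u uB; apply: contrapT => neq'; apply: (zmin w) => //.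
  by exists u.
apply: nv; rewrite FP; split=> [[_ _ [g [/in_pw gAB [Cg Pg]]]]|PF].
  by apply: loc Pg => // w u wz; apply: (uniq g F z).
by split=> //; exists F; split=> //; apply/in_pw.
Qed.

(* [h] need not be included in [a × b]: only its trace on it matters. *)
Definition bijb h a b : Prop :=
  (forall x, x ∈ a -> exists y, y ∈ b /\ op x y ∈ h) /\
  ((forall y, y ∈ b -> exists x, x ∈ a /\ op x y ∈ h) /\
  ((forall x, x ∈ a -> forall y, y ∈ b -> forall y', y' ∈ b ->
     op x y ∈ h -> op x y' ∈ h -> y = y') /\
   (forall x, x ∈ a -> forall x', x' ∈ a -> forall y, y ∈ b ->
     op x y ∈ h -> op x' y ∈ h -> x = x'))).

Definition eqv a b : Prop := exists h, h ⊆ prod a b /\ bijb h a b.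

Lemma bijb_eqv h a b : bijb h a b -> eqv a b.
Proof.
move=> [h1 [h2 [h3 h4]]].
have [|g [gab gP]] := @relP a b (fun x y => op x y ∈ h); first by dfn.
exists g; split=> //; split=> [x xa|]; last split=> [y yb|]; last split.
- by have [y [yb xy]] := h1 _ xa; exists y; split=> //; apply/gP.
- by have [x [xa xy]] := h2 _ yb; exists x; split=> //; apply/gP.
- by move=> x xa y yb y' yb' /gP[_ _ xy] /gP[_ _ xy']; apply: (h3 x).
- by move=> x xa x' xa' y yb /gP[_ _ xy] /gP[_ _ xy']; apply: (h4 x _ x' _ y).
Qed.

Lemma eqv_sym a b : eqv a b -> eqv b a.
Proof.
move=> [h [_ [h1 [h2 [h3 h4]]]]].
have [|g [gab gP]] := @relP b a (fun x y => op y x ∈ h); first by dfn.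
apply: (@bijb_eqv g); split=> [x xa|]; last split=> [y yb|]; last split.
- by have [y [yb xy]] := h2 _ xa; exists y; split=> //; apply/gP.
- by have [x [xa xy]] := h1 _ yb; exists x; split=> //; apply/gP.
- by move=> x xa y yb y' yb' /gP[_ _ xy] /gP[_ _ xy']; apply: (h4 y _ y' _ x).
- by move=> x xa x' xa' y yb /gP[_ _ xy] /gP[_ _ xy']; apply: (h3 y).
Qed.

Lemma eqv_trans a b c : eqv a b -> eqv b c -> eqv a c.
Proof.
move=> [h [_ [h1 [h2 [h3 h4]]]]] [k [_ [k1 [k2 [k3 k4]]]]].
have [|g [gab gP]] := @relP a c
  (fun x z => exists y, y ∈ b /\ (op x y ∈ h /\ op y z ∈ k)); first by dfn.
apply: (@bijb_eqv g); split=> [x xa|]; last split=> [z zc|]; last split.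
- have [y [yb xy]] := h1 _ xa; have [z [zc yz]] := k1 _ yb.
  by exists z; split=> //; apply/gP; split=> //; exists y.
- have [y [yb yz]] := k2 _ zc; have [x [xa xy]] := h2 _ yb.
  by exists x; split=> //; apply/gP; split=> //; exists y.
- move=> x xa z zc z' zc' /gP[_ _ [y [yb [xy yz]]]] /gP[_ _ [y' [yb' [xy' yz']]]].
  by have := h3 x xa y yb y' yb' xy xy'; move=> ?; subst y'; apply: (k3 y).
- move=> x xa x' xa' z zc /gP[_ _ [y [yb [xy yz]]]] /gP[_ _ [y' [yb' [xy' yz']]]].
  have := k4 y yb y' yb' z zc yz yz'; move=> ?; subst y'.
  by apply: (h4 x _ x' _ y).
Qed.

Lemma is_bijectionP a b : (exists f, is_bijection f a b) <-> eqv a b.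
Proof.
split=> [[f [[[fp ff fd] fb] fi fs]]|[h [hab [h1 [h2 [h3 h4]]]]]].
  apply: (@bijb_eqv f); split=> [x xa|]; last split=> [y yb|]; last split.
  - have [_ /(_ xa)[y xy]] := fd x.
    by exists y; split; [apply: fb xy|apply/appE].
  - have [x xy] := fs y yb; exists x; split; last exact/appE.
    by have [+ _] := fd x; apply; exists y.
  - by move=> x xa y yb y' yb' /appE xy /appE; apply: ff.
  - by move=> x xa x' xa' y yb /appE xy /appE; apply: fi.
have hD x y : app h x y -> x ∈ a /\ y ∈ b by move=> /appE/hab/op_prod.
exists h; split.
- split=> [|x y /hD[]//]; split=> [p /hab/in_prod[x [y [_ _ ->]]]|x y z xy xz|x].
  + by exists x, y; apply/opairE.
  + by have [xa yb] := hD _ _ xy; have [_ zb] := hD _ _ xz;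
      apply: (h3 x) => //; exact/appE.
  + split=> [[y /hD[]]//|/h1[y [yb xy]]]; by exists y; apply/appE.
- by move=> x y z xz yz; have [xa zb] := hD _ _ xz; have [ya _] := hD _ _ yz;
    apply: (h4 x _ y _ z) => //; exact/appE.
- by move=> y /h2[x [xa xy]]; exists x; apply/appE.
Qed.

Lemma has_cardE x l : has_card x l <-> is_cardinal l /\ eqv x l.
Proof. by rewrite /has_card is_bijectionP. Qed.

Lemma cardinalE x : is_cardinal x <-> is_ord x /\ forall y, y ∈ x -> ~ eqv x y.
Proof.
by split=> -[ox h]; split=> // y yx; [rewrite -is_bijectionP|rewrite is_bijectionP];
  exact: h.
Qed.

(** The Mostowski collapse of a set of ordinals, with the recursion clause that the value at [z] is
    the set of values at the members of [z]. *)
Lemma collapse k A : is_ord k -> A ⊆ k -> exists b F,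
  [/\ is_ord b, b ⊆ k, F ⊆ prod A k, bijb F A b
    & forall x y u v, op x u ∈ F -> op y v ∈ F -> (x ∈ y <-> u ∈ v)].
Proof.
move=> ok Ak; have [tk lk] := ok.
have [|||F [FAk FP]] := @recursion A k (fun z c g =>
    forall d, d ∈ k -> (d ∈ c <-> exists w, w ∈ z /\ op w d ∈ g)).
- by move=> x y z xA yx zy; apply: ord_trans zy yx; apply: (ord_mem ok (Ak _ xA)).
- by move=> s t u hs ht hu; dfn.
- move=> z v g g' zA gg' h d dk; rewrite h //.
  by split=> -[w [wz]] hw; exists w; split=> //; apply/gg'.
have Ffun x u v : op x u ∈ F -> op x v ∈ F -> u = v.
  move=> xu xv; have /op_prod[xA uk] := FAk _ xu; have /op_prod[_ vk] := FAk _ xv.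
  move/(FP _ _ xA uk): xu => hu; move/(FP _ _ xA vk): xv => hv.
  apply: ext => d; split=> hd.
    by have dk := ord_trans ok hd uk; apply/hv => //; apply/hu.
  by have dk := ord_trans ok hd vk; apply/hu => //; apply/hv.
have ozA z : z ∈ A -> is_ord z by move=> /Ak; apply: ord_mem.
have ztr x y z : z ∈ A -> x ∈ y -> y ∈ z -> x ∈ z by move=> /ozA; apply: ord_trans.
(* The bound by [z] is carried along because a value must be known to lie in [k] before it can enter
   [F]. *)
have tot z : z ∈ A -> exists c, c ∈ k /\ (op z c ∈ F /\ (c = z \/ c ∈ z)).
  move=> zA; apply: contrapT => nz.
  have [|{nz}{}z [{}zA nz zmin]] := @found A z (fun z =>
      ~ exists c, c ∈ k /\ (op z c ∈ F /\ (c = z \/ c ∈ z))) _ zA nz.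
    by dfn.
  have [|c cP] := @sepP k (fun d => exists w, w ∈ z /\ op w d ∈ F); first by dfn.
  have ct : transitive_set c.
    move=> d /cP[dk [w [wz wd]]] e ed; have /op_prod[wA _] := FAk _ wd.
    have ek := ord_trans ok ed dk; apply/cP; split=> //.
    have [+ _] := FP _ _ wA dk; move=> /(_ wd)/(_ e ek)[/(_ ed)[x [xw xe]] _].
    by exists x; split=> //; apply: ztr wz.
  have cz : c ⊆ z.
    move=> d /cP[dk [w [wz wd]]]; have /op_prod[wA _] := FAk _ wd.
    have [e [ek [we ew]]] : exists c, c ∈ k /\ (op w c ∈ F /\ (c = w \/ c ∈ w)).
      by apply: contrapT; exact: zmin wz wA.
    by rewrite (Ffun _ _ _ wd we); case: ew => [->//|ew]; apply: ztr ew wz.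
  have cz' := ord_sub (ozA _ zA) ct cz.
  have ck : c ∈ k by case: cz' => [->|cz'']; [exact: Ak|exact: ord_trans cz'' (Ak _ zA)].
  apply: nz; exists c; split=> //; split=> //.
  by apply/FP => // d dk; rewrite cP; split=> [[]|].
have mono x y u v : op x u ∈ F -> op y v ∈ F -> x ∈ y -> u ∈ v.
  move=> xu yv xy; have /op_prod[xA uk] := FAk _ xu; have /op_prod[yA vk] := FAk _ yv.
  by move/(FP _ _ yA vk): yv => hv; apply/hv => //; exists x.
have [|b bP] := @sepP k (fun c => exists z, z ∈ A /\ op z c ∈ F); first by dfn.
have tb : transitive_set b.
  move=> d /bP[dk [z [zA zd]]] e ed; have ek := ord_trans ok ed dk.
  have [+ _] := FP _ _ zA dk; move=> /(_ zd)/(_ e ek)[/(_ ed)[x [xz xe]] _].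
  by apply/bP; split=> //; exists x; split=> //; have /op_prod[] := FAk _ xe.
have bk : b ⊆ k by move=> c /bP[].
have Fiff x y u v : op x u ∈ F -> op y v ∈ F -> (x ∈ y <-> u ∈ v).
  move=> xu yv; split; first exact: mono xu yv.
  move=> uv; have /op_prod[xA uk] := FAk _ xu; have /op_prod[yA vk] := FAk _ yv.
  case: (lk x y (Ak _ xA) (Ak _ yA)) => // [xy|yx].
    by subst y; rewrite (Ffun _ _ _ xu yv) in uv; case: (mem_irr uv).
  by case: (mem_asym uv); apply: mono yx.
exists b, F; split=> //; first by split=> // x y /bk xk /bk yk; apply: lk.
split=> [x xA|]; last split=> [y /bP[_ [x []]]|]; last split.
- have [c [ck [xc _]]] := tot x xA.
  by exists c; split=> //; apply/bP; split=> //; exists x.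
- by exists x.
- by move=> x xA y yb y' yb'; apply: Ffun.
- move=> x xA x' xA' y yb xy xy'.
  case: (lk x x' (Ak _ xA) (Ak _ xA')) => // /Fiff h.
    by case: (@mem_irr y); apply: (h y y).
  by case: (@mem_irr y); apply: (h y y).
Qed.

Lemma card_exists k A : is_ord k -> A ⊆ k ->
  exists l, [/\ is_cardinal l, l ⊆ k & eqv A l].
Proof.
move=> ok Ak; have [b [F [ob bk FAk Fbij _]]] := collapse ok Ak.
(* The least ordinal equinumerous with [A] is sought in the successor of the order type [b], and the
   bijections in [pw (prod A b)]. *)
have [|||l [lb [h [/in_pw hAb hbij]] lmin]] := @found (cup b (pr b b)) b
    (fun l => exists h, h ∈ pw (prod A b) /\ bijb h A l).
- by rewrite /bijb; dfn.
- by apply/in_cup; right; apply/in_pr; left.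
- by have [h [hAb hbij]] := bijb_eqv Fbij; exists h; split=> //; apply/in_pw.
have {}lb : l = b \/ l ∈ b by case/in_cup: lb => [|/in_pr[]]; [right|left|left].
have ol : is_ord l by case: lb => [->//|]; apply: ord_mem.
have lb' : l ⊆ b by case: lb => [->//|]; case: ob => + _; apply.
have Al : eqv A l := bijb_eqv hbij.
exists l; split=> //; last exact: subset_trans bk.
apply/cardinalE; split=> // y yl /(eqv_trans Al)[g [gAy gbij]].
apply: (lmin y) => //; first by apply/in_cup; left; apply: lb'.
exists g; split=> //; apply/in_pw; apply: subset_trans gAy _.
by apply: prod_mono => //; apply: subset_trans lb'; case: ol => + _; apply.
Qed.

(** * The cut *)

Variable I : set M.
Hypothesis HI : H_cut I.

Lemma I_mem x y : I y -> x ∈ y -> I x.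
Proof. by move=> Iy; case: HI => _ [/(_ x y Iy)]. Qed.

Lemma I_sub x y : I y -> x ⊆ y -> I x.
Proof. by move=> Iy; case: HI => _ [_ /(_ x y Iy)]. Qed.

Lemma HS : MOST (substr I).
Proof. by case: HI. Qed.

Lemma I_pr x y : I x -> I y -> I (pr x y).
Proof.
move=> Ix Iy; have [[p Ip] pP] := Mac_pairing (MOST_Mac HS) (exist _ x Ix) (exist _ y Iy).
suff <- : p = pr x y by [].
apply: ext => z; rewrite in_pr; split=> [zp|h].
  by case: (iffLR (pP (exist _ z (I_mem Ip zp))) zp) => [[->]|[->]]; [left|right].
have Iz : I z by case: h => ->.
by apply: (iffRL (pP (exist _ z Iz))); case: h => h; [left|right]; subst z; congr exist;
  exact: Prop_irrelevance.
Qed.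

Lemma I_un x : I x -> I (un x).
Proof.
move=> Ix; have [[u Iu] uP] := Mac_union (MOST_Mac HS) (exist _ x Ix).
suff <- : u = un x by [].
apply: ext => z; rewrite in_un; split=> [zu|[y [yx zy]]].
  by have [[y Iy] [yx zy]] := iffLR (uP (exist _ z (I_mem Iu zu))) zu; exists y.
have Iy := I_mem Ix yx.
by apply: (iffRL (uP (exist _ z (I_mem Iy zy)))); exists (exist _ y Iy).
Qed.

(** The power set formed in [I] is the one of [M], since every subset in [M] of an element of [I]
    lies in [I]. *)
Lemma I_pw x : I x -> I (pw x).
Proof.
move=> Ix; have [[u Iu] uP] := Mac_powerset (MOST_Mac HS) (exist _ x Ix).
suff <- : u = pw x by [].
apply: ext => z; rewrite in_pw; split=> [zu w wz|zx].
  have Iz := I_mem Iu zu; have Iw := I_mem Iz wz.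
  exact: (iffLR (uP (exist _ z Iz)) zu (exist _ w Iw) wz).
by apply: (iffRL (uP (exist _ z (I_sub Ix zx)))) => -[w Iw] /= /zx.
Qed.

Lemma I_cup x y : I x -> I y -> I (cup x y).
Proof. by move=> Ix Iy; apply: I_un; apply: I_pr. Qed.

Lemma I_prod x y : I x -> I y -> I (prod x y).
Proof.
move=> Ix Iy; apply: (@I_sub _ (pw (pw (cup x y)))); first by do 2 apply: I_pw; apply: I_cup.
move=> p /in_prod[u [v [ux vy ->]]]; apply/in_pw => w /in_pr[]->;
  by apply/in_pw => z /in_pr[]->; apply/in_cup; by [left|right].
Qed.

Lemma I_empty : exists2 x, I x & is_empty x.
Proof.
have [[x Ix] xP] := Mac_emptyset (MOST_Mac HS); exists x => // z zx.
exact: (xP (exist _ z (I_mem Ix zx))).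
Qed.

Lemma I_transitive_containment x : I x -> exists y, [/\ I y, transitive_set y & x ⊆ y].
Proof.
move=> Ix; have [[y Iy] [yt xy]] := Mac_transitive_containment (MOST_Mac HS) (exist _ x Ix).
exists y; split=> // [u uy w wu|w wx].
  have Iu := I_mem Iy uy.
  exact: (yt (exist _ u Iu) uy (exist _ w (I_mem Iu wu))).
exact: (xy (exist _ w (I_mem Ix wx))).
Qed.

Lemma Ord_subE x : Ord_sub I x <-> I x /\ is_ord x.
Proof.
split=> [[Ix [tx lx]]|[Ix [tx lx]]].
  split=> //; split=> [y yx z zy|y z yx zx].
    have Iy := I_mem Ix yx.
    exact: (tx (exist _ y Iy) yx (exist _ z (I_mem Iy zy))).
  have := lx (exist _ y (I_mem Ix yx)) (exist _ z (I_mem Ix zx)) yx zx.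
  by case=> [yz|[->]|zy]; [constructor 1|constructor 2|constructor 3].
exists Ix; split=> [[y Iy] yx [z Iz] /= zy|[y Iy] [z Iz] /= yx zx]; first exact: tx zy.
case: (lx y z yx zx) => [yz|yz|zy]; [constructor 1|constructor 2|constructor 3] => //.
by subst z; congr exist; exact: Prop_irrelevance.
Qed.

Lemma I_ord_lt x k : is_ord k -> ~ I k -> is_ord x -> I x -> x ∈ k.
Proof.
move=> ok nIk ox Ix; case: (ord_lin ox ok) => // [xk|kx]; first by case: nIk; rewrite -xk.
by case: nIk; apply: I_mem kx.
Qed.

(** Burali-Forti: the set of ordinals in [A] would be an ordinal of [I], hence a member of
    itself. *)
Lemma no_ord_set A : I A -> ~ forall x, is_ord x -> I x -> x ∈ A.
Proof.
move=> IA h; have [|B BP] := @sepP A (@is_ord M).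
  rewrite /is_ord /transitive_set.
  apply: (@Dfn_ext _ _ (fun e => (forall y, y ∈ e 0 -> forall z, z ∈ y -> z ∈ e 0) /\
    (forall y, y ∈ e 0 -> forall z, z ∈ e 0 -> y ∈ z \/ (y = z \/ z ∈ y)))).
    move=> e; split=> -[h1 h2]; split=> // y.
      by move=> z yx zx; case: (h2 y yx z zx) => [|[]]; by constructor.
    by move=> yx z zx; case: (h2 y z yx zx) => [|->|]; [left|right; left|right; right].
  by dfn.
have IB : I B by apply: I_sub IA _ => x /BP[].
have oB : is_ord B.
  split=> [y /BP[yA oy] z zy|y z /BP[_ oy] /BP[_ oz]]; last exact: ord_lin.
  have oz := ord_mem oy zy; apply/BP; split=> //; apply: h => //.
  by apply: I_mem zy; apply: I_mem yA.
by apply: (@mem_irr B); apply/BP; split=> //; apply: h.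
Qed.

(** If the ordinals below [k] with [Q] were all in [I], toplessness would put the set of them in
    [I], although it contains every ordinal of [I]. *)
Lemma overspill k (Q : M -> Prop) : is_ord k -> ~ I k -> D (fun e => Q (e 0)) ->
  (forall x, is_ord x -> I x -> Q x) -> exists x, [/\ x ∈ k, ~ I x & Q x].
Proof.
move=> ok nIk /(sepP k)[A AP] h; apply: contrapT => nh.
have IA : I A.
  case: HI => -[_ _ +] _ _; apply=> x /AP[xk Qx]; apply/Ord_subE.
  split; last exact: ord_mem xk.
  by apply: contrapT => nIx; apply: nh; exists x.
apply: (no_ord_set IA) => x ox Ix; apply/AP; split; last exact: h.
exact: I_ord_lt.
Qed.

Lemma sat_abs (p : form) (e : nat -> substr I) : delta0 p ->
  (sat e p <-> sat (fun i => sval (e i)) p).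
Proof.
have sc (x : substr I) e' : (fun i => sval (scons x e' i)) = scons (sval x) (fun i => sval (e' i)).
  by apply: funext => -[].
elim: p e => //=.
- move=> i j e _; split=> [->//|]; case: (e i) (e j) => x Ix [y Iy] /= xy.
  by subst y; congr exist; exact: Prop_irrelevance.
- by move=> p IHp e /IHp ->.
- by move=> p IHp q IHq e /andP[/IHp-> /IHq->].
- by move=> p IHp q IHq e /andP[/IHp-> /IHq->].
- by move=> p IHp q IHq e /andP[/IHp-> /IHq->].
- move=> j p IHp e p0; split=> h.
    move=> x xj; have Ix := I_mem (proj2_sig (e j)) xj.
    by have /IHp := h (exist _ x Ix) xj; rewrite sc; apply.
  by move=> x xj; apply/IHp => //; rewrite sc; apply: h.
- move=> j p IHp e p0; split=> -[x [xj h]].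
    by exists (sval x); split=> //; move/IHp: h; rewrite sc; apply.
  have Ix := I_mem (proj2_sig (e j)) xj.
  by exists (exist _ x Ix); split=> //; apply/IHp => //; rewrite sc.
Qed.

Lemma I_formula (P : M -> M -> Prop) : Dfn I (fun e => P (e 1) (e 0)) ->
  exists q (e : nat -> substr I), delta0 q /\
    forall x y : substr I, sat (scons y (scons x e)) q <-> P (sval x) (sval y).
Proof.
move=> /(@Dfn_binder2 _ _ (fun=> P))[q [us [q0 tus h]]].
(* [P] does not look at the outer environment, so its variables may all be read as one element [d]
   of [I]. *)
have [d Id _] := I_empty.
have Iu i : I (us i (fun=> d)) by case: (tus i) => [[j ->]|[c [Ic ->]]].
exists q, (fun i => exist _ _ (Iu i)); split=> // x y.
rewrite sat_abs // -(h (fun=> d)); apply: iff_of_eq; congr (sat _ q).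
by apply: funext => -[|[]].
Qed.

Lemma I_separation1 a (P : M -> M -> Prop) : Dfn I (fun e => P (e 1) (e 0)) -> I a ->
  exists b, I b /\ forall x, x ∈ b <-> x ∈ a /\ exists y, I y /\ P x y.
Proof.
move=> /I_formula[q [e [q0 h]]] Ia.
have s1 : sigma1 (Fex q) by rewrite /=; case: q q0 {h}.
have [[b Ib] bP] := MOST_separation HS e (exist _ a Ia) s1.
exists b; split=> // x; split=> [xb|[xa [y [Iy Pxy]]]].
  have [xa [y /h Pxy]] := iffLR (bP (exist _ x (I_mem Ib xb))) xb.
  by split=> //; exists (sval y); split=> //; exact: proj2_sig.
apply: (iffRL (bP (exist _ x (I_mem Ia xa)))); split=> //.
by exists (exist _ y Iy); apply/h.
Qed.

Lemma I_collection a (P : M -> M -> Prop) : Dfn I (fun e => P (e 1) (e 0)) -> I a ->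
  (forall x, x ∈ a -> exists y, I y /\ P x y) ->
  exists b, I b /\ forall x, x ∈ a -> exists y, y ∈ b /\ P x y.
Proof.
move=> /I_formula[q [e [q0 h]]] Ia hP.
have [|[b Ib] bP] := MOST_collection HS (e := e) (a := exist _ a Ia) q0.
  by move=> [x Ix] /hP[y [Iy Pxy]]; exists (exist _ y Iy); apply/h.
exists b; split=> // x xa; have [[y Iy] [yb /h Pxy]] := bP (exist _ x (I_mem Ia xa)) xa.
by exists y.
Qed.

(** * Small sets *)

(** Codes from a set of [I] that determine their elements; an element may have several codes, so
    none has to be chosen. *)
Definition Small X : Prop := exists a g,
  [/\ I a, forall x, x ∈ X -> exists c, c ∈ a /\ op c x ∈ g
    & forall c x y, op c x ∈ g -> op c y ∈ g -> x = y].

(** [h] may be multivalued: totality and disjointness of the images are enough to pull smallness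
    back. *)
Definition inj h a b : Prop :=
  (forall x, x ∈ a -> exists y, y ∈ b /\ op x y ∈ h) /\
  (forall x, x ∈ a -> forall x', x' ∈ a -> forall y, y ∈ b ->
     op x y ∈ h -> op x' y ∈ h -> x = x').

Lemma eqv_inj a b : eqv a b -> exists h, inj h a b.
Proof. by move=> [h [_ [h1 [_ [_ h4]]]]]; exists h; split. Qed.

Lemma Small_sub X Y : X ⊆ Y -> Small Y -> Small X.
Proof. by move=> XY [a [g [Ia h1 h2]]]; exists a, g; split=> // x /XY/h1. Qed.

Lemma Small_inj h X Y : inj h X Y -> Small Y -> Small X.
Proof.
move=> [h1 h2] [a [g [Ia g1 g2]]].
have [|k [_ kP]] := @relP a X (fun c x => exists y, y ∈ Y /\ (op c y ∈ g /\ op x y ∈ h)).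
  by dfn.
exists a, k; split=> // [x xX|c x x' /kP[_ xX [y [yY [cy xy]]]] /kP[_ xX' [y' [yY' [cy' xy']]]]].
  have [y [yY xy]] := h1 x xX; have [c [ca cy]] := g1 y yY.
  by exists c; split=> //; apply/kP; split=> //; exists y.
by have ? := g2 _ _ _ cy cy'; subst y'; apply: (h2 x _ x' _ y).
Qed.

Lemma Small_I a : I a -> Small a.
Proof.
move=> Ia; have [|g [_ gP]] := @relP a a (fun x y => x = y); first by dfn.
exists a, g; split=> // [x xa|c x y /gP[_ _ <-] /gP[_ _ <-]//].
by exists x; split=> //; apply/gP.
Qed.

Lemma Small_eqv X Y : eqv X Y -> I Y -> Small X.
Proof. by move=> /eqv_inj[h hXY] /Small_I; exact: Small_inj hXY. Qed.

Lemma Small_union X Y Z : (forall x, x ∈ X -> x ∈ Y \/ x ∈ Z) ->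
  Small Y -> Small Z -> Small X.
Proof.
move=> XYZ [a [g [Ia g1 g2]]] [b [h [Ib h1 h2]]].
(* The empty set and its singleton serve as tags for the two systems of codes. *)
have [o Io oP] := I_empty; pose i := pr o o.
have oi : o <> i by move=> oi; apply: (oP o); rewrite {2}oi; apply/in_pr; left.
pose ab := prod (pr o i) (cup a b).
have [|k [_ kP]] := @relP ab X (fun c x => exists d, d ∈ cup a b /\
    ((c = op o d /\ op d x ∈ g) \/ (c = op i d /\ op d x ∈ h))).
  by dfn.
exists ab, k; split=> [|x xX|c x y /kP[_ _ [d [_ dP]]] /kP[_ _ [e [_ eP]]]].
- by apply: I_prod; [apply: I_pr => //; apply: I_pr|apply: I_cup].
- case: (XYZ x xX) => [/g1|/h1] [c [ca cx]].
    have cab : c ∈ cup a b by apply/in_cup; left.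
    exists (op o c); split; first by apply/op_prod; split=> //; apply/in_pr; left.
    apply/kP; split=> //; first by apply/op_prod; split=> //; apply/in_pr; left.
    by exists c; split=> //; left.
  have cab : c ∈ cup a b by apply/in_cup; right.
  exists (op i c); split; first by apply/op_prod; split=> //; apply/in_pr; right.
  apply/kP; split=> //; first by apply/op_prod; split=> //; apply/in_pr; right.
  by exists c; split=> //; right.
- case: dP eP => [[-> dx]|[-> dx]] [[/op_inj[E ?] ey]|[/op_inj[E ?] ey]]; subst e.
  + exact: g2 dx ey.
  + by case: oi.
  + by case: oi.
  + exact: h2 dx ey.
Qed.

(* Hartogs' argument inside [I]: a surjection from [a ∈ I] onto an ordinal
   [k ∉ I] would make every ordinal of [I] the order type of a chain of subsets
   of [a], and these order types are collected by a set of [I]. *)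
Lemma Small_ord k : is_ord k -> Small k -> I k.
Proof.
move=> ok [a [g [Ia g1 g2]]]; apply: contrapT => nIk.
(* [G x] is the set of codes of the members of [x]; on [k] it turns membership into strict inclusion
   between subsets of [a]. *)
have /choice[G GP] x : exists u, forall c,
    c ∈ u <-> c ∈ a /\ exists z, z ∈ x /\ op c z ∈ g.
  by apply: sepP; dfn.
have Gpw x : G x ∈ pw a by apply/in_pw => c /GP[].
have Glt x y : x ∈ k -> y ∈ k -> ((G x ⊆ G y /\ ~ G y ⊆ G x) <-> x ∈ y).
  have lt u v : u ∈ k -> v ∈ k -> u ∈ v -> (G u ⊆ G v /\ ~ G v ⊆ G u).
    move=> uk vk uv; split=> [c /GP[ca [z [zu cz]]]|GvGu].
      apply/GP; split=> //; exists z; split=> //.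
      by apply: ord_trans zu uv; apply: ord_mem vk.
    have [c [ca cu]] := g1 u uk.
    have /GvGu/GP[_ [z [zu cz]]] : c ∈ G v by apply/GP; split=> //; exists u.
    by rewrite (g2 _ _ _ cz cu) in zu; case: (mem_irr zu).
  move=> xk yk; split=> [[xy nyx]|]; last exact: lt.
  case: ok => _ /(_ x y xk yk)[//|E|yx]; first by case: nyx; rewrite E.
  by have [_] := lt _ _ yk xk yx.
have Ginj x y : x ∈ k -> y ∈ k -> G x = G y -> x = y.
  move=> xk yk E; case: ok => _ /(_ x y xk yk)[/(Glt _ _ xk yk)|//|/(Glt _ _ yk xk)];
    by rewrite E => -[].
(* [r] under strict inclusion is isomorphic to a transitive set [b]. Isomorphism and [b] are packed
   into one set [y], so that a single unbounded quantifier remains for Sigma_1 separation and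
   collection in [I]. *)
pose phi r y := exists h, h ∈ y /\ exists b, b ∈ y /\
  ((forall u, u ∈ b -> forall v, v ∈ u -> v ∈ b) /\
  ((forall u, u ∈ r -> exists x, x ∈ b /\ op u x ∈ h) /\
  ((forall x, x ∈ b -> exists u, u ∈ r /\ op u x ∈ h) /\
   (forall u, u ∈ r -> forall v, v ∈ r -> forall x, x ∈ b -> forall y, y ∈ b ->
      op u x ∈ h -> op v y ∈ h -> ((u ⊆ v /\ ~ v ⊆ u) <-> x ∈ y))))).
have Dphi : Dfn I (fun e => phi (e 1) (e 0)) by rewrite /phi; dfn.
have [S [IS SP]] := I_separation1 Dphi (I_pw (I_pw Ia)).
have [|B [IB BP]] := I_collection Dphi IS; first by move=> r /SP[].
apply: (no_ord_set (I_un IB)) => al oal Ial.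
have alk z : z ∈ al -> z ∈ k.
  by move=> zal; apply: (ord_trans ok zal); apply: I_ord_lt.
have isG u z : u ∈ pw a -> ((forall c, c ∈ a ->
    (c ∈ u <-> exists w, w ∈ z /\ op c w ∈ g)) <-> u = G z).
  move=> /in_pw ua; split=> [h|-> c ca]; last by rewrite GP; split=> [[]|].
  by apply: ext => c; rewrite GP; split=> [cu|[ca cz]]; [split; [exact: ua|apply/h => //; exact: ua]|exact/h].
(* [g] need not lie in [I], but the chain [r] and the isomorphism [h] defined from it are included
   in sets of [I], hence belong to [I]. *)
have [|r rP0] := @sepP (pw a) (fun u => exists z, z ∈ al /\
    forall c, c ∈ a -> (c ∈ u <-> exists w, w ∈ z /\ op c w ∈ g)); first by dfn.
have rP u : u ∈ r <-> exists z, z ∈ al /\ u = G z.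
  rewrite rP0; split=> [[upw [z [zal /isG-> //]]]|[z [zal ->]]]; first by exists z.
  by split=> //; exists z; split=> //; apply/isG.
have [|h [hsub hP]] := @relP r al (fun u z => forall c, c ∈ a ->
    (c ∈ u <-> exists w, w ∈ z /\ op c w ∈ g)); first by dfn.
have hG z : z ∈ al -> op (G z) z ∈ h.
  by move=> zal; apply/hP; split=> //; [apply/rP; exists z|apply/isG].
have rpw : r ⊆ pw a by move=> u /rP0[].
have Ir : I r by apply: I_sub rpw; apply: I_pw.
have Ih : I h by apply: I_sub hsub; apply: I_prod.
have hE u z : op u z ∈ h -> u = G z.
  by move=> /hP[/rpw uP zal /isG]; apply.
have rS : r ∈ S.
  apply/SP; split; first by apply/in_pw.
  exists (pr h al); split; first exact: I_pr.
  exists h; split; first by apply/in_pr; left.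
  exists al; split; first by apply/in_pr; right.
  split=> [u ual v vu|]; first exact: ord_trans vu ual.
  split=> [u /rP[z [zal ->]]|]; first by exists z; split=> //; apply: hG.
  split=> [x xal|]; first by exists (G x); split; [apply/rP; exists x|apply: hG].
  move=> u _ v _ x xal y yal /hE-> /hE->; apply: Glt; exact: alk.
have [y [yB [h' [_ [b [by_ [tb [b1 [b2 b3]]]]]]]]] := BP _ rS.
(* Collection returns some transitive [b] isomorphic to the chain; rigidity identifies it with
   [al]. *)
have key z x : z ∈ al -> x ∈ b -> op (G z) x ∈ h' -> z = x.
  move=> zal0 xb0 zx0; apply: contrapT => nzx0.
  have [||{zal0 zx0 nzx0}z [zal [{xb0}x [xb [[u [ur [uz ux]]] nzx]]] zmin]] := @found al z
      (fun z => exists x, x ∈ b /\ ((exists u, u ∈ r /\ (op u z ∈ h /\ op u x ∈ h'))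
         /\ z <> x)) _ zal0.
  - by dfn.
  - exists x; split=> //; split=> //; exists (G z).
    by split; [apply/rP; exists z|split=> //; exact: hG].
  have Gr w : w ∈ al -> G w ∈ r by move=> wal; apply/rP; exists w.
  have ? := hE _ _ uz; subst u.
  have eq w y' : w ∈ al -> w ∈ z -> y' ∈ b -> op (G w) y' ∈ h' -> w = y'.
    move=> wal wz yb wy; apply: contrapT => nwy; apply: (zmin w) => //.
    by exists y'; split=> //; split=> //; exists (G w); split; [exact: Gr|split; first exact: hG].
  apply: nzx; apply: ext => w; split=> [wz|wx].
    have wal := ord_trans oal wz zal.
    have [y' [yb wy]] := b1 _ (Gr _ wal).
    rewrite (eq w y') //; apply/(b3 _ (Gr _ wal) _ ur _ yb _ xb wy ux).
    by apply/Glt => //; exact: alk.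
  have wb := tb _ xb _ wx; have [_ [/rP[v [val ->]] vw]] := b2 _ wb.
  have vz : v ∈ z.
    by apply/Glt; rewrite ?(b3 _ (Gr _ val) _ ur _ wb _ xb vw ux) //; exact: alk.
  by rewrite -(eq v w).
suff -> : al = b by apply/in_un; exists y.
apply: ext => z; split=> [zal|zb].
  have [|x [xb zx]] := b1 (G z); first by apply/rP; exists z.
  by rewrite (key z x).
by have [_ [/rP[v [val ->]] vz]] := b2 _ zb; rewrite -(key v z).
Qed.

(** * The Erdos-Rado tree and end-homogeneous sets *)

Variable k : M.
Hypothesis ok : is_ord k.
Hypothesis nIk : ~ I k.

Lemma linear_k x y : x ∈ k -> y ∈ k -> [\/ x ∈ y, x = y | y ∈ x].
Proof. by case: ok => _; apply. Qed.

Lemma k_trans x y z : z ∈ k -> x ∈ y -> y ∈ z -> x ∈ z.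
Proof. by move=> zk; apply: ord_trans; exact: ord_mem zk. Qed.

(** The order type of [A] is compared with [al]. The second alternative keeps the order, because the
    codes of the tree record positions on a branch. *)
Lemma inj_or_emb A al : A ⊆ k -> al ∈ k ->
  (exists h, h ⊆ prod al A /\ inj h al A) \/
  (exists h, [/\ h ⊆ prod A al, forall x, x ∈ A -> exists u, u ∈ al /\ op x u ∈ h
     & forall x y u v, op x u ∈ h -> op y v ∈ h -> (x ∈ y <-> u ∈ v)]).
Proof.
move=> Ak alk; have oal := ord_mem ok alk.
have [b [F [ob bk FAk [F1 [F2 [F3 F4]]] Fo]]] := collapse ok Ak.
case: (pselect (b ∈ al)) => [bal|nbal]; [right|left].
  have [|h [hAal hP]] := @relP A al (fun x u => op x u ∈ F); first by dfn.
  exists h; split=> // [x xA|x y u v /hP[_ _ xu] /hP[_ _ yv]]; last exact: Fo.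
  have [u [ub xu]] := F1 x xA.
  have ual := ord_trans oal ub bal.
  by exists u; split=> //; apply/hP.
have alb : al ⊆ b.
  by case: (ord_lin ob oal) => // [<-//|]; case: ob => + _; apply.
have [|h [hsub hP]] := @relP al A (fun u x => op x u ∈ F); first by dfn.
exists h; split=> //; split=> [u ual|u ual v val x xA /hP[_ _ xu] /hP[_ _ xv]].
  have [x [xA xu]] := F2 u (alb _ ual).
  by exists x; split=> //; apply/hP.
by apply: (F3 x) => //; apply: alb.
Qed.

(* [T x y] says that [x] lies on the branch of the Erdos-Rado tree below [y]: the
   branch is built upwards, keeping [x] when it is coloured as [y] over every [s]
   included in the part of the branch below [x]. *)
Section Tree.
Variables (X F : M) (R : M -> M -> Prop).
Hypothesis Xk : X ⊆ k.
Hypothesis DR : forall s t : (nat -> M) -> M, term setT s -> term setT t ->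
  D (fun e => R (s e) (t e)).
Hypothesis FXX : F ⊆ prod X X.
Hypothesis FP : forall x y, x ∈ X -> y ∈ X -> (op x y ∈ F <->
  x ∈ y /\ forall s, s ∈ pw k -> s ⊆ x -> (forall w, w ∈ s -> op w y ∈ F) ->
    (R s x <-> R s y)).

Local Notation T x y := (op x y ∈ F).

Lemma tree_field x y : T x y -> x ∈ X /\ y ∈ X.
Proof. by move=> /FXX/op_prod. Qed.

Lemma tree_lt x y : T x y -> x ∈ y.
Proof. by move=> xy; have [xX yX] := tree_field xy; move/(FP xX yX): xy => []. Qed.

Lemma tree_R x y s : T x y -> s ⊆ x -> (forall w, w ∈ s -> T w y) -> (R s x <-> R s y).
Proof.
move=> xy sx sy; have [xX yX] := tree_field xy; move/(FP xX yX): (xy) => [_]; apply=> //.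
by apply/in_pw => w /sx wx; apply: ord_trans wx (Xk xX).
Qed.

(** Here [x] and [x'] are points of two branches, or their end nodes. If [x] belonged to [x'], the
    colour hypothesis would place [x] on the branch of [y'] below [x'], and the inclusion of initial
    parts would give [x] in itself. Used both ways round, this leaves only [x = x']. *)
Lemma tree_key x x' y y' : x ∈ X -> y' ∈ X -> x = y \/ T x y -> x' = y' \/ T x' y' ->
  (forall z, T z y' /\ z ∈ x' -> T z y /\ z ∈ x) ->
  (forall s, s ⊆ k -> (forall z, z ∈ s -> T z y /\ z ∈ x) -> (R s y <-> R s y')) ->
  ~ x ∈ x'.
Proof.
move=> xX yX' xy xy' sub Rs xx'.
suff Txy' : T x y' by have [_ /mem_irr] := sub x (conj Txy' xx').
apply/FP => //; split.
  by case: xy' => [<-//|/tree_lt]; apply: k_trans xx'; exact: Xk.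
move=> s /in_pw sk sx sy.
have hs z : z ∈ s -> T z y /\ z ∈ x.
  move=> zs; apply: sub; split; first exact: sy.
  have [zX _] := tree_field (sy _ zs).
  case: xy' => [->|/tree_field[x'X _]]; first exact: tree_lt (sy _ zs).
  exact: k_trans (Xk x'X) (sx _ zs) xx'.
rewrite -Rs //; case: xy => [->//|xy].
by apply: tree_R => // w /hs[].
Qed.

(* The code of a node [y]: an order embedding [h] of its branch into [al], the
   image [d] of the branch, and the images [e] of the [s] with [R s y]. *)
Definition codes al h d e y : Prop :=
  (forall x, x ∈ X -> T x y -> exists u, u ∈ al /\ op x u ∈ h) /\
  ((forall x, x ∈ X -> forall x', x' ∈ X -> forall u, u ∈ al -> forall u', u' ∈ al ->
     T x y -> T x' y -> op x u ∈ h -> op x' u' ∈ h -> (x ∈ x' <-> u ∈ u')) /\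
  ((forall u, u ∈ al -> (u ∈ d <-> exists x, x ∈ X /\ (T x y /\ op x u ∈ h))) /\
   (forall a, a ∈ pw al -> (a ∈ e <-> exists s, s ∈ pw k /\
      ((forall w, w ∈ s -> T w y) /\ (R s y /\
       forall u, u ∈ al -> (u ∈ a <-> exists x, x ∈ s /\ op x u ∈ h))))))).

(** [bel] marks the positions below [x] on one branch and below [x'] on the other. Where the decoded
    points agree, a set [s] has the same image in [al] under both embeddings, and the common [e]
    decides [R] for both nodes. *)
Lemma codes_transfer al h d e y h' y' x x' (bel : M -> Prop) :
  codes al h d e y -> codes al h' d e y' ->
  (forall z u, T z y -> u ∈ al -> op z u ∈ h -> (z ∈ x <-> bel u)) ->
  (forall z u, T z y' -> u ∈ al -> op z u ∈ h' -> (z ∈ x' <-> bel u)) ->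
  (forall z z' u, u ∈ al -> bel u -> T z y -> T z' y' ->
     op z u ∈ h -> op z' u ∈ h' -> z = z') ->
  (forall z, T z y /\ z ∈ x -> T z y' /\ z ∈ x') /\
  (forall s, s ⊆ k -> (forall z, z ∈ s -> T z y /\ z ∈ x) -> R s y -> R s y').
Proof.
move=> [c1 [_ [c3 c4]]] [c1' [_ [c3' c4']]] b b' agr; split=> [z [zy zx]|s sk hs Rs].
  have [zX yX] := tree_field zy; have [u [ual zu]] := c1 z zX zy.
  have [z' [_ [zy' zu']]] : exists x, x ∈ X /\ (T x y' /\ op x u ∈ h').
    by apply/c3' => //; apply/c3 => //; exists z.
  have belu : bel u by apply/(b z).
  by have ? := agr z z' u ual belu zy zy' zu zu'; subst z'; split=> //; apply/(b' z u).
have [|a aP] := @sepP al (fun u => exists x, x ∈ s /\ op x u ∈ h); first by dfn.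
have apw : a ∈ pw al by apply/in_pw => u /aP[].
have /(c4' _ apw)[s' [s'k [sy' [Rs' s'P]]]] : a ∈ e.
  apply/c4 => //; exists s; split; first exact/in_pw.
  by split=> [w /hs[]//|]; split=> // u ual; rewrite aP; split=> [[]|].
suff -> : s = s' by [].
apply: ext => w; split=> [ws|ws'].
  have [wy wx] := hs w ws; have [wX yX] := tree_field wy.
  have [u [ual wu]] := c1 w wX wy.
  have /(s'P _ ual)[w' [ws' wu']] : u ∈ a by apply/aP; split=> //; exists w.
  have belu : bel u by apply/(b w).
  by rewrite (agr w w' u ual belu wy (sy' _ ws') wu wu').
have wy' := sy' _ ws'; have [wX yX] := tree_field wy'.
have [u [ual wu']] := c1' w wX wy'.
have /aP[_ [w' [ws wu]]] : u ∈ a by apply/s'P => //; exists w.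
have [wy wx] := hs _ ws.
have belu : bel u by apply/(b w').
by rewrite -(agr w' w u ual belu wy wy' wu wu').
Qed.

(** At the least position where the decoded points differ, the branches agree below, and [tree_key]
    forces equality. Once the whole branches agree, the same argument applies to the nodes [y] and
    [y'] themselves. *)
Lemma codes_inj al h d e y h' y' : y ∈ X -> y' ∈ X ->
  codes al h d e y -> codes al h' d e y' -> y = y'.
Proof.
move=> yX yX' cy cy'.
have main x x' (bel : M -> Prop) : x ∈ X -> x' ∈ X -> x = y \/ T x y -> x' = y' \/ T x' y' ->
    (forall z u, T z y -> u ∈ al -> op z u ∈ h -> (z ∈ x <-> bel u)) ->
    (forall z u, T z y' -> u ∈ al -> op z u ∈ h' -> (z ∈ x' <-> bel u)) ->
    (forall z z' u, u ∈ al -> bel u -> T z y -> T z' y' ->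
       op z u ∈ h -> op z' u ∈ h' -> z = z') -> x = x'.
  move=> xX xX' xy xy' b b' agr.
  have agr' z z' u : u ∈ al -> bel u -> T z y' -> T z' y ->
      op z u ∈ h' -> op z' u ∈ h -> z = z'.
    by move=> ? ? ? ? ? ?; apply: esym; apply: (agr _ _ u).
  have [P1 R1] := codes_transfer cy cy' b b' agr.
  have [P2 R2] := codes_transfer cy' cy b' b agr'.
  case: (linear_k (Xk xX) (Xk xX')) => // xx'; exfalso; move: xx'.
    apply: tree_key xX yX' xy xy' P2 _ => s sk hs; split; first exact: R1.
    by apply: R2 => // z /hs /P1.
  apply: tree_key xX' yX xy' xy P1 _ => s sk hs; split; first exact: R2.
  by apply: R1 => // z /hs /P2.
have [_ [c2 _]] := cy; have [_ [c2' _]] := cy'.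
have agr z z' u : u ∈ al -> T z y -> T z' y' -> op z u ∈ h -> op z' u ∈ h' -> z = z'.
  move=> ual0 zy0 zy0' zu0 zu0'; apply: contrapT => nzz.
  have [zX0 _] := tree_field zy0; have [zX0' _] := tree_field zy0'.
  have [||v [val [x [xX [x' [xX' [xy [xy' [xv [xv' nxx]]]]]]]] vmin]] := @found al u
      (fun u => exists x, x ∈ X /\ exists x', x' ∈ X /\
         (T x y /\ (T x' y' /\ (op x u ∈ h /\ (op x' u ∈ h' /\ x <> x'))))) _ ual0.
  - by dfn.
  - by exists z; split=> //; exists z'.
  apply: nxx; apply: (main x x' (fun u => u ∈ v)) => //; try by right.
  - by move=> w t wy tal wt; have [wX _] := tree_field wy; apply: c2.
  - by move=> w t wy tal wt; have [wX _] := tree_field wy; apply: c2'.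
  - move=> w w' t tal tv wy wy' wt wt'; apply: contrapT => nww.
    have [wX _] := tree_field wy; have [wX' _] := tree_field wy'.
    by apply: (vmin t) => //; exists w; split=> //; exists w'.
apply: (main y y' (fun=> True)) => //; try by left.
- by move=> z u /tree_lt.
- by move=> z u /tree_lt.
- by move=> z z' u ual _; exact: agr.
Qed.

Lemma tree_branch al : ~ Small X -> is_ord al -> I al ->
  exists y, y ∈ X /\ exists h, h ∈ pw (prod k k) /\
    ((forall u, u ∈ al -> exists x, x ∈ X /\ (T x y /\ op u x ∈ h)) /\
     (forall u, u ∈ al -> forall u', u' ∈ al -> forall x, x ∈ X ->
        op u x ∈ h -> op u' x ∈ h -> u = u')).
Proof.
move=> nSX oal Ial; apply: contrapT => nh; apply: nSX.
have alk : al ∈ k by apply: I_ord_lt.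
have alk' : al ⊆ k by case: ok => + _; apply.
(* Only [d] and [e] form the code. The embedding [h] need not lie in [I], and [codes_inj] recovers
   the node without it. *)
pose W := prod (pw al) (pw (pw al)).
have IW : I W by apply: I_prod; do ?apply: I_pw.
have [|g [_ gP]] := @relP W X (fun c y => exists h, h ∈ pw (prod k k) /\
    exists d, d ∈ pw al /\ exists e, e ∈ pw (pw al) /\ (c = op d e /\ codes al h d e y)).
  by rewrite /codes; dfn; apply: DR; dterm.
exists W, g; split=> // [y yX|c y y' /gP[_ yX [h [_ [d [_ [e [_ [-> cy]]]]]]]]
    /gP[_ yX' [h' [_ [d' [_ [e' [_ [/op_inj[? ?] cy']]]]]]]]]; last first.
  by subst d' e'; apply: codes_inj cy cy'.
have [|A AP] := @sepP X (fun x => T x y); first by dfn.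
have Ak : A ⊆ k by move=> x /AP[/Xk].
case: (inj_or_emb Ak alk) => [[h [hsub [h1 h2]]]|[h [hsub h1 h2]]].
  case: nh; exists y; split=> //; exists h; split.
    by apply/in_pw; apply: subset_trans hsub _; apply: prod_mono.
  split=> [u ual|u ual u' ual' x xX ux ux'].
    by have [x [/AP[xX xy] ux]] := h1 u ual; exists x.
  have /op_prod[_ xA] := hsub _ ux.
  exact: (h2 u ual u' ual' x).
have [|d dP] := @sepP al (fun u => exists x, x ∈ X /\ (T x y /\ op x u ∈ h)); first by dfn.
have [|e eP] := @sepP (pw al) (fun a => exists s, s ∈ pw k /\
      ((forall w, w ∈ s -> T w y) /\ (R s y /\
       forall u, u ∈ al -> (u ∈ a <-> exists x, x ∈ s /\ op x u ∈ h)))).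
  by dfn; apply: DR; dterm.
have dpw : d ∈ pw al by apply/in_pw => u /dP[].
have epw : e ∈ pw (pw al) by apply/in_pw => u /eP[].
have cW : op d e ∈ W by apply/op_prod.
exists (op d e); split=> //; apply/gP; split=> //; exists h; split.
  by apply/in_pw; apply: subset_trans hsub _; apply: prod_mono.
exists d; split=> //; exists e; split=> //; split=> //; split=> [x xX xy|].
  by apply: h1; apply/AP.
split=> [x xX x' xX' u ual u' ual' _ _|]; first exact: h2.
by split=> [u ual|a apw]; [rewrite dP|rewrite eP]; split=> [[]|].
Qed.

End Tree.

Lemma end_homogeneous X (R : M -> M -> Prop) : X ⊆ k -> ~ Small X ->
  (forall s t : (nat -> M) -> M, term setT s -> term setT t -> D (fun e => R (s e) (t e))) ->
  exists Y, [/\ Y ⊆ X, ~ Small Y & forall s x y, s ⊆ Y -> x ∈ Y -> y ∈ Y ->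
    s ⊆ x -> s ⊆ y -> (R s x <-> R s y)].
Proof.
move=> Xk nSX DR.
have [|||F [FXX FP]] := @recursion X X (fun x y F => x ∈ y /\
    forall s, s ∈ pw k -> s ⊆ x -> (forall w, w ∈ s -> op w y ∈ F) -> (R s x <-> R s y)).
- by move=> x y z /Xk xk yx zy; apply: k_trans zy yx.
- by move=> s t u hs ht hu; dfn; apply: DR; dterm.
- move=> x y g g' xX gg' [xy h]; split=> // s sk sx sy; apply: h => // w ws.
  by apply/gg'; [exact: sx|exact: sy].
have [||th [thk nIth [y [yX [h [_ [h1 h2]]]]]]] := @overspill k (fun al =>
    exists y, y ∈ X /\ exists h, h ∈ pw (prod k k) /\
    ((forall u, u ∈ al -> exists x, x ∈ X /\ (op x y ∈ F /\ op u x ∈ h)) /\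
     (forall u, u ∈ al -> forall u', u' ∈ al -> forall x, x ∈ X ->
        op u x ∈ h -> op u' x ∈ h -> u = u'))) ok nIk.
- by dfn.
- by move=> al; apply: tree_branch FP _ _.
have [|Y YP] := @sepP X (fun x => op x y ∈ F); first by dfn.
exists Y; split=> [x /YP[]//| |s x x' sY /YP[xX xy] /YP[xX' xy'] sx sx'].
  move=> SY; apply: nIth; apply: Small_ord; first exact: ord_mem thk.
  apply: (@Small_inj h _ Y) => //; split=> [u uth|u uth u' uth' x /YP[xX _]].
    by have [x [xX [xy ux]]] := h1 u uth; exists x; split=> //; apply/YP.
  exact: h2.
have sy w : w ∈ s -> op w y ∈ F by move=> /sY/YP[].
(* Over [s], both points of the branch are coloured as its end node [y]. *)
by rewrite (tree_R Xk FXX FP xy sx sy) (tree_R Xk FXX FP xy' sx' sy).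
Qed.

(** * Finite subsets and Ramsey's theorem *)

Lemma increasing_sub n Y Z (ss : 'I_n -> M) : Y ⊆ Z -> increasing_in Y ss -> increasing_in Z ss.
Proof. by move=> YZ [h1 h2]; split=> // i; apply: YZ. Qed.

Lemma increasing_inj n Y (ss : 'I_n -> M) : increasing_in Y ss -> injective ss.
Proof.
move=> [_ h] i j E; apply: val_inj; case: (ltngtP i j) => // /h; rewrite E => /mem_irr [].
Qed.

Lemma increasing_lt n Y (ss : 'I_n -> M) i j : increasing_in Y ss ->
  ss i ∈ ss j -> (i < j)%N.
Proof.
move=> [_ h] ij; case: (ltngtP i j) => // [/h /(mem_asym ij)[]|/val_inj E].
by rewrite E in ij; case: (mem_irr ij).
Qed.

Lemma increasing_uniq n Y Z (ss ts : 'I_n -> M) s : increasing_in Y ss -> increasing_in Z ts ->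
  enumerates ss s -> enumerates ts s -> ss = ts.
Proof.
move=> hs ht es et; apply: funext => -[i].
elim/ltn_ind: i => i IH ilt; set o := Ordinal ilt.
have [j oj] : exists j, ss o = ts j by apply/et/es; exists o.
have [l ol] : exists l, ts o = ss l by apply/es/et; exists o.
have ge (j' : 'I_n) : ss o = ts j' -> (i <= j')%N.
  move=> E; rewrite leqNgt; apply/negP => lt; have := IH j' lt (ltn_ord j').
  rewrite (_ : Ordinal _ = j'); last exact: val_inj.
  by rewrite -E => /(increasing_inj hs) jo; rewrite jo /= ltnn in lt.
have ge' (l' : 'I_n) : ts o = ss l' -> (i <= l')%N.
  move=> E; rewrite leqNgt; apply/negP => lt; have := IH l' lt (ltn_ord l').
  rewrite (_ : Ordinal _ = l'); last exact: val_inj.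
  by rewrite -E => /(increasing_inj ht) lo; rewrite -lo /= ltnn in lt.
have := ge _ oj; rewrite leq_eqVlt => /orP[/eqP ij|ij].
  by rewrite oj; congr ts; apply: val_inj.
have := ge' _ ol; rewrite leq_eqVlt => /orP[/eqP il|il].
  by rewrite ol; congr ss; apply: val_inj.
have h1 : ts o ∈ ss o by rewrite oj; apply: ht.2.
have h2 : ss o ∈ ts o by rewrite ol; apply: hs.2.
by case: (mem_asym h1).
Qed.

(** Standard finite sets are sorted outside [M], with the classical equality of [{classic M}]; the
    order is total and transitive only on elements of [k], whence the relativised sorting lemmas. *)
Lemma sorted_enum (l : seq {classic M}) :
  (forall z : {classic M}, z \in l -> mem_in (z : M) k) ->
  exists us : 'I_(size (undup l)) -> M,
    increasing_in k us /\ forall z : {classic M}, z \in l <-> exists i, us i = z.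
Proof.
move=> lk; pose le : rel {classic M} := fun x y => `[< (x : M) = y \/ mem_in (x : M) y >].
pose P : pred {classic M} := fun x => `[< mem_in (x : M) k >].
pose s := sort le (undup l).
have sl (z : {classic M}) : (z \in s) = (z \in l) by rewrite /s mem_sort mem_undup.
have Ps : all P s by apply/allP => z; rewrite sl => /lk zk; apply/asboolP.
have tot : {in P &, total le}.
  move=> x y /asboolP xk /asboolP yk; apply/orP.
  case: (linear_k xk yk) => h; [left|left|right]; apply/asboolP;
    by [right|left|right].
have tr : {in P & &, transitive le}.
  move=> y x z _ _ /asboolP zk /asboolP[->//|xy] /asboolP[<-|yz]; apply/asboolP; right=> //.
  exact: k_trans xy yz.
have ss : sorted le s.
  by apply: sort_sorted_in tot _ _; apply/allP => z; rewrite mem_undup => /lk zk; apply/asboolP.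
have sz : size s = size (undup l) by rewrite /s size_sort.
have us : uniq s by rewrite /s sort_uniq undup_uniq.
exists (fun i => nth (k : {classic M}) s i); split; first split.
- by move=> i; apply: lk; rewrite -sl mem_nth // sz.
- move=> i j ij.
  have il : (i < size s)%N by rewrite sz.
  have jl : (j < size s)%N by rewrite sz.
  have /asboolP := sorted_ltn_nth_in tr (k : {classic M}) Ps ss i j il jl ij.
  case=> [E|//]; have {}E : nth (k : {classic M}) s i = nth (k : {classic M}) s j by exact: E.
  move/eqP: E; rewrite nth_uniq ?sz // => /eqP E.
  by rewrite E ltnn in ij.
- move=> z; rewrite -sl; split=> [zs|[i <-]]; last by rewrite mem_nth // sz.
  have ilt : (index z s < size (undup l))%N by rewrite -sz index_mem.
  by exists (Ordinal ilt); rewrite /= nth_index.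
Qed.

Lemma nsubsetsE n Y s : Y ⊆ k ->
  nsubsets n Y s <-> exists ss : 'I_n -> M, increasing_in Y ss /\ enumerates ss s.
Proof.
move=> Yk; split=> [[xs [ixs xsY es]]|[ss [hs es]]]; last first.
  by exists ss; split=> //; [exact: increasing_inj hs|case: hs].
pose l : seq {classic M} := [seq (xs i : {classic M}) | i <- enum 'I_n].
have szl : size (undup l) = n.
  have ul : uniq l by rewrite /l map_inj_uniq ?enum_uniq.
  by rewrite undup_id // /l size_map size_enum_ord.
have lP (z : {classic M}) : z \in l <-> exists i, z = xs i.
  split=> [/mapP[i _ ->]|[i ->]]; first by exists i.
  by apply: map_f; rewrite mem_enum.
have [|us [ius uP]] := @sorted_enum l; first by move=> z /lP[i ->]; apply: Yk.
move: us ius uP; rewrite szl => us ius uP; exists us; split; last first.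
  move=> z; rewrite (es z) -(lP z) (uP z).
  by split=> -[i E]; exists i.
split; last by case: ius.
by move=> i; have /lP[j ->] : (us i : {classic M}) \in l by apply/uP; exists i.
Qed.

Lemma enumerated_set n Y (ss : 'I_n -> M) : (forall i, ss i ∈ Y) ->
  exists s, s ⊆ Y /\ enumerates ss s.
Proof.
move=> hs; have [|s sP] := @sepP Y (fun z => exists i, z = ss i).
  by apply: Dfn_ex_ord => i; dfn.
by exists s; split=> [z /sP[]//|z]; rewrite sP; split=> [[]//|[i ->]]; split=> //; exists i.
Qed.

Lemma ramsey n r X : X ⊆ k -> ~ Small X -> exists Y, [/\ Y ⊆ X, ~ Small Y
  & (forall s, nsubsets n Y s -> s ∈ r) \/ (forall s, nsubsets n Y s -> ~ s ∈ r)].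
Proof.
elim: n r X => [|n IHn] r X Xk nSX.
  exists X; split=> //; case: (pselect (exists s, nsubsets 0 X s /\ s ∈ r)) => [h|nh]; [left|right].
    move: h => [s [[xs [_ _ es]] sr]] t [ys [_ _ et]].
    suff -> : t = s by [].
    by apply: ext => z; rewrite es et; split=> -[[]].
  by move=> s hs sr; apply: nh; exists s.
(* A Delta_0 rendering of: the union of [s] and the singleton of [x] belongs to [r]. *)
pose R s x := exists u, u ∈ r /\
  ((forall z, z ∈ u -> z ∈ s \/ z = x) /\ (s ⊆ u /\ x ∈ u)).
have DR (s t : (nat -> M) -> M) : term setT s -> term setT t -> D (fun e => R (s e) (t e)).
  by move=> hs ht; rewrite /R; dfn.
have [Y [YX nSY YP]] := end_homogeneous Xk nSX DR.
have Yk := subset_trans YX Xk.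
(* On [Y] the colour does not depend on the point put above [s], so it induces a colouring [r'] of
   the [n]-subsets. *)
have [|r' r'P] := @sepP (pw k) (fun s => exists x, x ∈ Y /\ (s ⊆ x /\ R s x)).
  by rewrite /R; dfn.
have [Z [ZY nSZ hZ]] := IHn r' Y Yk nSY.
have Zk := subset_trans ZY Yk.
exists Z; split=> //; first exact: subset_trans YX.
have main u : nsubsets n.+1 Z u -> exists s, nsubsets n Z s /\ (s ∈ r' <-> u ∈ r).
  move=> /(nsubsetsE _ _ Zk)[ss [hs es]]; pose x := ss ord_max.
  have xZ : x ∈ Z by apply: hs.1.
  have [|s sP] := @sepP u (fun z => z ∈ x); first by dfn.
  have uE z : z ∈ u <-> z ∈ s \/ z = x.
    rewrite sP; split=> [zu|[[]//|->]]; last by apply/es; exists ord_max.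
    have [i zi] := iffLR (es z) zu.
    case: (unliftP ord_max i) => [j|] E; last by right; rewrite zi E.
    left; split=> //; rewrite zi; apply: hs.2.
    by rewrite E lift_max /=.
  have sZ : s ⊆ Z by move=> z /sP[/es[i ->] _]; apply: hs.1.
  have sx : s ⊆ x by move=> z /sP[].
  exists s; split.
    apply/nsubsetsE => //; exists (fun i => ss (lift ord_max i)); split; first split.
    - by move=> i; apply: hs.1.
    - by move=> i j ij; apply: hs.2; rewrite !lift_max.
    - move=> z; rewrite sP; split=> [[/es[i zi] zx]|[i ->]].
        case: (unliftP ord_max i) => [j E|E]; first by exists j; rewrite zi E.
        by rewrite zi E in zx; case: (mem_irr zx).
      by split; [apply/es; exists (lift ord_max i)|apply: hs.2; rewrite lift_max].
  have RE : R s x <-> u ∈ r.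
    split=> [[u' [ur [h1 [h2 h3]]]]|ur]; last first.
      by exists u; split=> //; split=> [z /uE//|]; split=> [z zs|]; apply/uE; [left|right].
    suff -> : u = u' by [].
    by apply: ext => z; rewrite uE; split=> [[/h2|->]|/h1].
  rewrite r'P -RE; split=> [[_ [x' [xY' [sx' Rx']]]]|Rx].
    apply/(YP s x x') => //; [exact: subset_trans ZY|exact: ZY].
  split; first by apply/in_pw; apply: subset_trans Zk.
  by exists x; split=> //; exact: ZY.
case: hZ => hZ; [left|right] => u /main[s [/hZ hs <-]] //.
Qed.

Lemma refine (T : finType) (H : T -> M -> Prop) :
  (forall (i : T) Y Z, H i Y -> Z ⊆ Y -> H i Z) ->
  (forall (i : T) X, X ⊆ k -> ~ Small X -> exists Y, [/\ Y ⊆ X, ~ Small Y & H i Y]) ->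
  forall X, X ⊆ k -> ~ Small X -> exists Y, [/\ Y ⊆ X, ~ Small Y & forall i, H i Y].
Proof.
move=> her dense X Xk nSX.
suff [Y [YX nSY h]] : exists Y, [/\ Y ⊆ X, ~ Small Y & forall i, i \in enum T -> H i Y].
  by exists Y; split=> // i; apply: h; rewrite mem_enum.
elim: (enum T) => [|i l [Y [YX nSY h]]]; first by exists X; split=> // i; rewrite in_nil.
have [Z [ZY nSZ hZ]] := dense i Y (subset_trans YX Xk) nSY.
exists Z; split=> //; first exact: subset_trans YX.
by move=> j; rewrite inE => /orP[/eqP->//|/h hY]; apply: her ZY.
Qed.

Lemma Small_single x : Small (pr x x).
Proof.
have [o Io _] := I_empty.
have [|g [_ gP]] := @relP (pr o o) (pr x x) (fun c y => y = x); first by dfn.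
exists (pr o o), g; split; first exact: I_pr.
  move=> y yx; have yE : y = x by case/in_pr: (yx).
  by exists o; split; [|apply/gP; split=> //]; apply/in_pr; left.
by move=> c y z /gP[_ _ ->] /gP[_ _ ->].
Qed.

(** Above the least element of a non-small set there is still a non-small set. *)
Lemma large_increasing m Y : Y ⊆ k -> ~ Small Y -> exists us : 'I_m -> M, increasing_in Y us.
Proof.
elim: m Y => [|m IHm] Y Yk nSY; first by exists (fun=> k); split=> -[].
have [x0 x0Y] : exists x, x ∈ Y.
  apply: contrapT => nY; apply: nSY; have [o Io _] := I_empty.
  by apply: Small_sub (Small_I Io) => z zY; case: nY; exists z.
have [|x [xY _ xmin]] := @found Y x0 (fun=> True) (Dfn_prop _ True) x0Y; first by [].
have [|Z ZP] := @sepP Y (fun y => x ∈ y); first by dfn.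
have ZY : Z ⊆ Y by move=> z /ZP[].
have nSZ : ~ Small Z.
  move=> SZ; apply: nSY; apply: Small_union SZ (Small_single x) => y yY.
  case: (linear_k (Yk _ xY) (Yk _ yY)) => [xy|<-|yx]; first by left; apply/ZP.
    by right; apply/in_pr; left.
  by case: (xmin y).
have [us [u1 u2]] := IHm Z (subset_trans ZY Yk) nSZ.
exists (consf x us); split=> [i|i j]; rewrite /consf.
  by case: unlift => // j; apply: ZY.
case: (unliftP ord0 i) => [i'|] ->; case: (unliftP ord0 j) => [j'|] -> //.
- by rewrite !lift0 ltnS; exact: u2.
- by move=> _; have /ZP[] := u1 j'.
Qed.

(** * From homogeneous equality patterns to canonical sets *)

Section Patterns.
Variables (n : nat) (Y : M) (E : ('I_n -> M) -> ('I_n -> M) -> Prop).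
Hypothesis Yk : Y ⊆ k.
Hypothesis nSY : ~ Small Y.
Hypothesis E_refl : forall ss, increasing_in Y ss -> E ss ss.
Hypothesis E_sym : forall ss ts, E ss ts -> E ts ss.
Hypothesis E_trans : forall ss ts us, increasing_in Y ts -> E ss ts -> E ts us -> E ss us.
(** A pair of [n]-tuples uses at most [2n] points, and moving one coordinate uses [n + 1]; both
    numbers are below the bound. *)
Hypothesis E_hom : forall m (a b : 'I_n -> 'I_m) (us vs : 'I_m -> M), (m < n.*2.+2)%N ->
  increasing_in Y us -> increasing_in Y vs ->
  E (us \o a) (us \o b) -> E (vs \o a) (vs \o b).

(** The canonical set of coordinates will be the complement. One instance suffices here because
    [E_hom] spreads it to all tuples ([free_E]). *)
Definition free (i : 'I_n) : Prop := exists ss ts : 'I_n -> M,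
  [/\ increasing_in Y ss, increasing_in Y ts, forall j, j != i -> ss j = ts j,
      ss i ∈ ts i & E ss ts].

(** Omitting position [c + 1] or position [c] from [m.+1] points gives two [m]-tuples that differ
    only at [c]; single coordinates are moved in this way. *)
Lemma lift_skip m (c : 'I_m) (j : 'I_m) : j != c ->
  lift (lift ord0 c) j = lift (widen_ord (leqnSn m) c) j.
Proof.
move=> jc; apply: val_inj; rewrite /= /bump /=.
have {jc} : nat_of_ord j != c by [].
by case: (ltngtP j c).
Qed.

Lemma lift_skip_eq m (c : 'I_m) :
  lift (lift ord0 c) c = widen_ord (leqnSn m) c /\
  lift (widen_ord (leqnSn m) c) c = lift ord0 c.
Proof. by split; apply: val_inj; rewrite /= /bump /= ?leqnn ?ltnn. Qed.

Lemma skip_increasing m (us : 'I_m.+1 -> M) (c : 'I_m.+1) :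
  increasing_in Y us -> increasing_in Y (us \o lift c).
Proof.
move=> [u1 u2]; split=> [i|i j ij] /=; first exact: u1.
by apply: u2; rewrite ltnNge leq_bump2 -ltnNge.
Qed.

(** Conversely, tuples that differ only at [i] come from [n.+1] points, with [ts i] inserted right
    after [ss i]. *)
Lemma interpolate (i : 'I_n) ss ts : increasing_in Y ss -> increasing_in Y ts ->
  (forall j, j != i -> ss j = ts j) -> ss i ∈ ts i ->
  exists us : 'I_n.+1 -> M, [/\ increasing_in Y us, us \o lift (lift ord0 i) = ss
    & us \o lift (widen_ord (leqnSn n) i) = ts].
Proof.
move=> [s1 s2] [t1 t2] st sti; pose ip : 'I_n.+1 := lift ord0 i.
pose us (c : 'I_n.+1) := if unlift ip c is Some j then ss j else ts i.
have usl j : us (lift ip j) = ss j by rewrite /us liftK.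
have usi : us ip = ts i by rewrite /us unlift_none.
exists us; split; first split.
- by move=> c; rewrite /us; case: unlift.
- move=> c d; case: (unliftP ip c) => [j|] ->; case: (unliftP ip d) => [j'|] ->;
    rewrite ?usl ?usi ?ltnn //.
  + by move=> jj; apply: s2; rewrite ltnNge -(leq_bump2 ip) -ltnNge.
  + move=> /= jj; have ji : (j <= i)%N.
      by move: jj; rewrite /bump /= /bump /= !add1n ltnS; case: leqP => //= ij; lia.
    move: ji; rewrite leq_eqVlt => /orP[/eqP/val_inj->//|ji].
    have ne : j != i by rewrite -val_eqE neq_ltn ji.
    by rewrite (st _ ne); apply: t2.
  + move=> /= jj; have ij : (i < j')%N.
      by move: jj; rewrite /bump /= /bump /= !add1n; case: ltnP => //= ij; lia.
    have ne : j' != i by rewrite -val_eqE neq_ltn ij orbT.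
    by rewrite (st _ ne); apply: t2.
- by apply: funext => j /=; rewrite usl.
- apply: funext => j /=; have [->|ji] := eqVneq j i.
    by have [_ ->] := lift_skip_eq i; rewrite usi.
  by rewrite -lift_skip // usl st.
Qed.

Lemma free_E (i : 'I_n) ss ts : free i -> increasing_in Y ss -> increasing_in Y ts ->
  (forall j, j != i -> ss j = ts j) -> ss i ∈ ts i -> E ss ts.
Proof.
move=> [ss' [ts' [hs' ht' st' sti' E']]] hs ht st sti.
have [us [hu <- <-]] := interpolate hs ht st sti.
have [vs [hv vs1 vs2]] := interpolate hs' ht' st' sti'.
apply: E_hom hv hu _; last by rewrite vs1 vs2.
by have := ltn_ord i; lia.
Qed.

(* As [i] is the first difference, [ss i] is not among the [ts j]; so it can be slid
   inside [Y] while the pattern of the pair, hence [E], is kept. *)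
Lemma E_free (i : 'I_n) ss ts : increasing_in Y ss -> increasing_in Y ts -> E ss ts ->
  (forall j : 'I_n, (j < i)%N -> ss j = ts j) -> ss i ∈ ts i -> free i.
Proof.
move=> hs ht Est agr sti.
pose l : seq {classic M} := [seq (ss j : {classic M}) | j <- enum 'I_n] ++
                            [seq (ts j : {classic M}) | j <- enum 'I_n].
have lP (z : {classic M}) : z \in l -> mem_in (z : M) Y.
  by rewrite mem_cat => /orP[] /mapP[j _ ->]; [apply: hs.1|apply: ht.1].
have [|us [hu uP]] := @sorted_enum l; first by move=> z /lP/Yk.
have szl : (size (undup l) < n.*2.+2)%N.
  apply: leq_ltn_trans (size_undup _) _.
  have sz (f : 'I_n -> {classic M}) : size [seq f j | j <- enum 'I_n] = n.
    by rewrite size_map size_enum_ord.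
  by rewrite /l size_cat !sz; lia.
move: us hu uP; move: (size (undup l)) szl => m lm us hu uP.
have {}hu : increasing_in Y us.
  by split; [move=> j; apply: lP; apply/uP; exists j|case: hu].
have /choice[a aP] j : exists c : 'I_m, us c = ss j.
  by apply/uP; rewrite mem_cat map_f // mem_enum.
have /choice[b bP] j : exists c : 'I_m, us c = ts j.
  by apply/uP; rewrite mem_cat orbC map_f // mem_enum.
have a_mono (j j' : 'I_n) : (j < j')%N -> (a j < a j')%N.
  by move=> jj; apply: (increasing_lt hu); rewrite !aP; apply: hs.2.
(* [Y] may offer no room next to [ss i], so the pattern is moved to fresh points, one more than it
   needs. Both [us1] and [us2] give the same [b]-tuple, which links the two [a]-tuples by
   transitivity. *)
have [ws hw] := large_increasing m.+1 Yk nSY.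
pose c := a i; pose us1 := ws \o lift (lift ord0 c); pose us2 := ws \o lift (widen_ord (leqnSn m) c).
have h1 : increasing_in Y us1 by apply: skip_increasing.
have h2 : increasing_in Y us2 by apply: skip_increasing.
have us12 j : j != c -> us1 j = us2 j by move=> jc; rewrite /us1 /us2 /= lift_skip.
have bc j : b j != c.
  apply/eqP => bjc; have tj : ts j = ss i by rewrite -bP bjc aP.
  case: (ltngtP j i) => [ji|ij|/val_inj ji].
  - have := increasing_inj hs (etrans (agr _ ji) tj) => E'.
    by rewrite E' ltnn in ji.
  - by have := ht.2 _ _ ij; rewrite tj => /(mem_asym sti).
  - by rewrite -tj ji in sti; case: (mem_irr sti).
have ub : us1 \o b = us2 \o b by apply: funext => j; apply: us12.
have inc_a (vs : 'I_m -> M) : increasing_in Y vs -> increasing_in Y (vs \o a).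
  by move=> [v1 v2]; split=> [j|j j' jj] /=; [exact: v1|apply: v2; exact: a_mono].
have inc_b (vs : 'I_m -> M) : increasing_in Y vs -> increasing_in Y (vs \o b).
  move=> [v1 v2]; split=> [j|j j' jj] /=; [exact: v1|apply: v2].
  by apply: (increasing_lt hu); rewrite !bP; apply: ht.2.
have Eab : E (us \o a) (us \o b).
  rewrite (_ : us \o a = ss); last by apply: funext => j; exact: aP.
  by rewrite (_ : us \o b = ts) //; apply: funext => j; exact: bP.
exists (us1 \o a), (us2 \o a); split; [exact: inc_a|exact: inc_a| | |].
- move=> j ji /=; apply: us12; apply: contraNneq ji => ajc.
  apply/eqP/val_inj; case: (ltngtP j i) => // /a_mono; by rewrite ajc ltnn.
- have [e1 e2] := lift_skip_eq c; rewrite /us1 /us2 /= -/c e1 e2.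
  by apply: hw.2.
- apply: (@E_trans _ (us1 \o b)); first exact: inc_b.
    exact: E_hom Eab.
  by apply: E_sym; rewrite ub; apply: E_hom Eab.
Qed.

(** Induction on the number of coordinates not yet known to agree. The first difference is free by
    [E_free], so the larger entry can be lowered to the smaller one within its class, which
    lengthens the agreement and leaves the non-free coordinates alone. *)
Lemma E_agree (d : nat) ss ts : (d <= n)%N -> increasing_in Y ss -> increasing_in Y ts -> E ss ts ->
  (forall j : 'I_n, (j < n - d)%N -> ss j = ts j) -> forall i, ~ free i -> ss i = ts i.
Proof.
elim: d ss ts => [|d IHd] ss ts dn hs ht Est agr i nfi.
  by apply: agr; rewrite subn0.
have i0n : (n - d.+1 < n)%N by lia.
pose i0 := Ordinal i0n.
have ltS (j : 'I_n) : (j < n - d)%N -> j = i0 \/ (j < n - d.+1)%N.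
  by move=> jd; case: (ltngtP j (n - d.+1)) => jj; [right|lia|left; apply: val_inj].
have step ss' ts' : increasing_in Y ss' -> increasing_in Y ts' -> E ss' ts' ->
    (forall j : 'I_n, (j < n - d.+1)%N -> ss' j = ts' j) -> ss' i0 ∈ ts' i0 -> ss' i = ts' i.
  move=> hs' ht' Est' agr' lt0.
  have f0 : free i0 by apply: E_free lt0.
  have ii0 : i != i0 by apply/eqP => ii; rewrite ii in nfi.
  pose us j := if j == i0 then ss' i0 else ts' j.
  have hu : increasing_in Y us.
    split=> [j|j j' jj]; first by rewrite /us; case: eqP => _; [apply: hs'.1|apply: ht'.1].
    rewrite /us; case: (eqVneq j i0) => [E0|j0]; case: (eqVneq j' i0) => [E0'|j0'].
    - by rewrite E0 E0' ltnn in jj.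
    - by apply: k_trans lt0 _; [apply/Yk/ht'.1|apply: ht'.2; rewrite -E0].
    - by rewrite -agr'; [apply: hs'.2; rewrite -E0'|move: jj; rewrite E0'].
    - exact: ht'.2.
  have Eut : E us ts'.
    apply: (free_E f0) => //; last by rewrite /us eqxx.
    by move=> j j0; rewrite /us (negbTE j0).
  have := IHd ss' us (ltnW dn) hs' hu (E_trans ht' Est' (E_sym Eut)) _ i nfi.
  rewrite /us (negbTE ii0); apply=> j /ltS[->|jd]; first by rewrite eqxx.
  by case: eqP => [->//|_]; apply: agr'.
case: (linear_k (Yk (hs.1 i0)) (Yk (ht.1 i0))) => [|eq0|]; first exact: step.
  by apply: (IHd ss ts (ltnW dn)) => // j /ltS[->//|/agr].
move=> lt0; apply: esym; apply: step => //; first exact: E_sym.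
by move=> j /agr.
Qed.

(** Coordinates are raised from the last to the first, which keeps the intermediate tuples [hy]
    increasing. *)
Lemma free_raise ss ms : increasing_in Y ss -> increasing_in Y ms ->
  (forall j, ss j = ms j \/ (ss j ∈ ms j /\ free j)) -> E ss ms.
Proof.
move=> hs hm sm; pose hy (d : nat) (j : 'I_n) := if (j < d)%N then ss j else ms j.
have le j z : z ∈ ss j -> z ∈ ms j.
  move=> zs; case: (sm j) => [<-//|[sj _]]; apply: k_trans zs sj.
  by apply: Yk; apply: hm.1.
have hhy (d : nat) : increasing_in Y (hy d).
  split=> [j|i j ij]; first by rewrite /hy; case: ifP => _; [apply: hs.1|apply: hm.1].
  rewrite /hy; case: (ltnP i d) => id; case: (ltnP j d) => jd.
  - exact: hs.2.
  - by apply: le; apply: hs.2.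
  - by have := leq_trans id (ltnW ij); rewrite leqNgt jd.
  - exact: hm.2.
suff h (d : nat) : (d <= n)%N -> E ss (hy (n - d)).
  have -> : ms = hy (n - n) by apply: funext => j; rewrite /hy subnn.
  exact: h.
elim: d => [|d IHd] dn.
  rewrite (_ : hy (n - 0) = ss); first exact: E_refl.
  by apply: funext => j; rewrite /hy subn0 ltn_ord.
apply: E_trans (IHd (ltnW dn)) _ => //.
have i0n : (n - d.+1 < n)%N by lia.
pose i0 := Ordinal i0n.
have off j : j != i0 -> hy (n - d) j = hy (n - d.+1) j.
  move=> j0; rewrite /hy; have {j0} : nat_of_ord j != (n - d.+1)%N by [].
  by move=> j0; rewrite (_ : (j < n - d)%N = (j < n - d.+1)%N) //; lia.
have at1 : hy (n - d) i0 = ss i0 by rewrite /hy /= (_ : (_ < _)%N) //; lia.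
have at2 : hy (n - d.+1) i0 = ms i0 by rewrite /hy /= ltnn.
case: (sm i0) => [eq0|[lt0 f0]]; last first.
  by apply: (free_E f0) => //; rewrite at1 at2.
rewrite (_ : hy (n - d.+1) = hy (n - d)); first exact: E_refl.
apply: funext => j; have [->|/off//] := eqVneq j i0.
by rewrite at1 at2.
Qed.

Lemma pattern_canonical : exists Dl : {set 'I_n}, forall ss ts,
  increasing_in Y ss -> increasing_in Y ts ->
  (E ss ts <-> forall i, i \in Dl -> ss i = ts i).
Proof.
exists [set i | ~~ `[< free i >]]%SET => ss ts hs ht; split=> [Est i|agr].
  rewrite inE => /asboolPn; apply: (E_agree (leqnn n)) => // j.
  by rewrite subnn.
have fr j : ss j <> ts j -> free j.
  by move=> ne; apply: contrapT => nf; apply: ne; apply: agr; rewrite inE; apply/asboolPn.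
(* Changing [ss] into [ts] one coordinate at a time could destroy monotonicity; both are raised to
   their coordinatewise maximum instead. *)
pose ms j := if pselect (ss j ∈ ts j) then ts j else ss j.
have sm j : ss j = ms j \/ (ss j ∈ ms j /\ free j).
  rewrite /ms; case: pselect => st /=; [right; split=> //|by left].
  by apply: fr => E0; move: st; rewrite E0 => /mem_irr.
have tm j : ts j = ms j \/ (ts j ∈ ms j /\ free j).
  rewrite /ms; case: pselect => st /=; first by left.
  case: (linear_k (Yk (hs.1 j)) (Yk (ht.1 j))) => // [->|lt']; [by left|right].
  by split=> //; apply: fr => E0; move: lt'; rewrite E0 => /mem_irr.
have hm : increasing_in Y ms.
  have mY j : ms j ∈ Y by rewrite /ms; case: pselect => st /=; [apply: ht.1|apply: hs.1].
  split=> // i j ij; rewrite {1}/ms; case: pselect => st /=.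
    have lt := ht.2 _ _ ij; case: (tm j) => [<-//|[tj _]].
    by apply: k_trans lt tj; apply: Yk.
  have lt := hs.2 _ _ ij; case: (sm j) => [<-//|[sj _]].
  by apply: k_trans lt sj; apply: Yk.
apply: (E_trans hm (free_raise hs hm sm)).
exact: E_sym (free_raise ht hm tm).
Qed.

End Patterns.

(** * Canonical sets *)

(* [enumerates] with its quantifiers bounded, so that [val] is visibly Delta_0. *)
Definition val n f (ss : 'I_n -> M) v : Prop :=
  exists s, s ∈ un (un f) /\ (((forall z, z ∈ s -> exists i, z = ss i) /\
    (forall i, ss i ∈ s)) /\ op s v ∈ f).

(** With Kuratowski pairs the double union of [f] contains arguments and values, and so bounds the
    quantifiers over them. *)
Lemma op_un2 s v f : op s v ∈ f -> s ∈ un (un f) /\ v ∈ un (un f).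
Proof.
move=> sv; have h : pr s v ∈ un f.
  by apply/in_un; exists (op s v); split=> //; apply/in_pr; right.
by split; apply/in_un; exists (pr s v); split=> //; apply/in_pr; [left|right].
Qed.

Lemma enumeratesE n (ss : 'I_n -> M) s : enumerates ss s <->
  (forall z, z ∈ s -> exists i, z = ss i) /\ (forall i, ss i ∈ s).
Proof.
split=> [h|[h1 h2] z]; first by split=> [z /h//|i]; apply/h; exists i.
by split=> [/h1//|[i ->]].
Qed.

Lemma valE n f (ss : 'I_n -> M) v : val f ss v <-> exists s, enumerates ss s /\ app f s v.
Proof.
split=> [[s [_ [/enumeratesE es sv]]]|[s [/enumeratesE es /appE sv]]].
  by exists s; split=> //; apply/appE.
by exists s; split=> //; have [] := op_un2 sv.
Qed.

Lemma enumerates_uniq n (ss : 'I_n -> M) s t : enumerates ss s -> enumerates ss t -> s = t.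
Proof. by move=> es et; apply: ext => z; rewrite es et. Qed.

Lemma Dfn_val n f (ss : 'I_n -> (nat -> M) -> M) (v : (nat -> M) -> M) :
  (forall i, term setT (ss i)) -> term setT v -> D (fun e => val f (fun i => ss i e) (v e)).
Proof.
move=> hs hv; rewrite /val; dfn.
- by apply: Dfn_ex_ord => i; apply: Dfn_eq; [exact: term_var|apply: term_ren].
- by apply: Dfn_all_ord => i; apply: Dfn_mem; [apply: term_ren|exact: term_var].
Qed.

Lemma Dfn_increasing n (ss : 'I_n -> (nat -> M) -> M) : (forall i, term setT (ss i)) ->
  D (fun e => forall i j : 'I_n, (i < j)%N -> ss i e ∈ ss j e).
Proof.
move=> hs; apply: Dfn_all_ord => i; apply: Dfn_all_ord => j.
by apply: Dfn_imp; [exact: Dfn_prop|apply: Dfn_mem].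
Qed.

Section Canonical.
Variables (n : nat) (f : M).
Hypothesis f_fun : is_function_on f (nsubsets n k).

Lemma val_total (ss : 'I_n -> M) : increasing_in k ss -> exists v, val f ss v.
Proof.
move=> hs; have [s [sk es]] := enumerated_set hs.1.
have [_ _ fd] := f_fun.
have /fd[v sv] : nsubsets n k s by apply/nsubsetsE => //; exists ss.
by exists v; apply/valE; exists s.
Qed.

Lemma val_fun (ss : 'I_n -> M) u v : val f ss u -> val f ss v -> u = v.
Proof.
move=> /valE[s [es su]] /valE[t [et tv]].
rewrite -(enumerates_uniq es et) in tv.
by have [_ ff _] := f_fun; exact: ff su tv.
Qed.

Definition eqval (ss ts : 'I_n -> M) : Prop :=
  exists v, v ∈ un (un f) /\ (val f ss v /\ val f ts v).

Lemma val_un2 (ss : 'I_n -> M) v : val f ss v -> v ∈ un (un f).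
Proof. by move=> [s [_ [_ /op_un2[]]]]. Qed.

Lemma eqval_refl (ss : 'I_n -> M) : increasing_in k ss -> eqval ss ss.
Proof. by move=> /val_total[v hv]; exists v; split=> //; exact: val_un2 hv. Qed.

Lemma eqval_sym ss ts : eqval ss ts -> eqval ts ss.
Proof. by move=> [v [vf [h1 h2]]]; exists v. Qed.

Lemma eqval_trans ss ts us : eqval ss ts -> eqval ts us -> eqval ss us.
Proof.
move=> [v [vf [h1 h2]]] [w [wf [h3 h4]]]; exists v; split=> //; split=> //.
by rewrite (val_fun h2 h3).
Qed.

Definition pattern_hom m (a b : 'I_n -> 'I_m) Y : Prop :=
  forall us vs : 'I_m -> M, increasing_in Y us -> increasing_in Y vs ->
    eqval (us \o a) (us \o b) -> eqval (vs \o a) (vs \o b).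

(** Ramsey's theorem for exponent [m], for the colour that tells whether [f] takes equal values on
    the two subtuples picked by [a] and [b]. *)
Lemma pattern_dense m (a b : 'I_n -> 'I_m) X : X ⊆ k -> ~ Small X ->
  exists Y, [/\ Y ⊆ X, ~ Small Y & pattern_hom a b Y].
Proof.
move=> Xk nSX.
have [|r rP] := @sepP (pw k) (fun w => exists ws : 'I_m -> M, (forall i, ws i ∈ w) /\
    ((forall i j : 'I_m, (i < j)%N -> ws i ∈ ws j) /\
     ((forall z, z ∈ w -> exists i, z = ws i) /\ eqval (ws \o a) (ws \o b)))).
  apply: (@Dfn_ex_tuple _ _ _ (fun e => e 0) (fun e ws =>
    ((forall i j : 'I_m, (i < j)%N -> ws i ∈ ws j) /\
     ((forall z, z ∈ e 0 -> exists i, z = ws i) /\ eqval (ws \o a) (ws \o b))))).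
    exact: term_var.
  move=> r ts tts; apply: Dfn_and; first exact: Dfn_increasing.
  apply: Dfn_and.
    apply: Dfn_all_in; first exact: term_var.
    by apply: Dfn_ex_ord => i; apply: Dfn_eq; [exact: term_var|apply: term_ren].
  rewrite /eqval; apply: Dfn_ex_in; first by dterm.
  apply: Dfn_and.
    apply: (@Dfn_val _ _ (fun i e => ts (a i) (fun n => e n.+1)) (fun e => e 0)).
      by move=> i; apply: term_ren.
    exact: term_var.
  apply: (@Dfn_val _ _ (fun i e => ts (b i) (fun n => e n.+1)) (fun e => e 0)).
    by move=> i; apply: term_ren.
  exact: term_var.
have [Y [YX nSY hY]] := ramsey m r Xk nSX.
exists Y; split=> //.
have Yk := subset_trans YX Xk.
have main (us : 'I_m -> M) : increasing_in Y us ->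
    exists w, nsubsets m Y w /\ (w ∈ r <-> eqval (us \o a) (us \o b)).
  move=> hu; have [w [wY ew]] := enumerated_set hu.1.
  exists w; split; first by apply/nsubsetsE => //; exists us.
  rewrite rP; split=> [[_ [ws [wsw [wi [we wab]]]]]|uab].
    suff <- : ws = us by [].
    by apply: increasing_uniq hu _ ew; [split; [exact: wsw|exact: wi]|apply/enumeratesE].
  split; first by apply/in_pw; apply: subset_trans Yk.
  by exists us; split; [move=> i; apply/ew; exists i|split; [exact: hu.2|split=> // z /ew]].
move=> us vs /main[w [hw <-]] /main[w' [hw' <-]] wr.
by case: hY => [|/(_ w hw)//]; apply.
Qed.

Lemma canonical_dense X : X ⊆ k -> ~ Small X ->
  exists Y, [/\ Y ⊆ X, ~ Small Y & is_canonical n f Y].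
Proof.
move=> Xk nSX; pose N := n.*2.+2.
have her m (a b : 'I_n -> 'I_m) Y Z : pattern_hom a b Y -> Z ⊆ Y -> pattern_hom a b Z.
  by move=> h ZY us vs hu hv; apply: h; exact: increasing_sub ZY _.
(* The patterns are taken as finite functions so that they form a [finType] and [refine] treats them
   all. *)
have [||Y [YX nSY hY]] := @refine 'I_N (fun m Y => forall ab : {ffun 'I_n -> 'I_m} * {ffun 'I_n -> 'I_m},
    pattern_hom ab.1 ab.2 Y) _ _ X Xk nSX.
- by move=> m Y Z h ZY ab; apply: her (h ab) ZY.
- move=> m; apply: refine => [ab Y Z|ab Y Yk nSY]; first exact: her.
  exact: pattern_dense.
have Yk := subset_trans YX Xk.
exists Y; split=> //.
have [||||Dl DlP] := @pattern_canonical n Y eqval Yk nSY.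
- by move=> ss hs; apply: eqval_refl; exact: increasing_sub Yk _.
- exact: eqval_sym.
- by move=> ss ts us _; exact: eqval_trans.
- move=> m a b us vs mN hu hv uab.
  have ea (ws : 'I_m -> M) (c : 'I_n -> 'I_m) : ws \o [ffun i => c i] = ws \o c.
    by apply: funext => i; rewrite /= ffunE.
  have := hY (Ordinal mN) ([ffun i => a i], [ffun i => b i]) us vs hu hv.
  by rewrite /= !ea; apply.
exists Dl => ss ts hs ht s t u v es et su tv.
rewrite -DlP //; split=> [uv|[w [_ [sw tw]]]].
  have hu : val f ss u by apply/valE; exists s.
  by exists u; split; [exact: val_un2 hu|split=> //; apply/valE; exists t; rewrite uv].
have hu : val f ss u by apply/valE; exists s.
have hv : val f ts v by apply/valE; exists t.
by rewrite (val_fun hu sw) (val_fun hv tw).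
Qed.

(** For a coordinate [i] in the canonical set the value determines the [i]-th entry. Hence [r]
    injects entries into values, and few values account for few entries. *)
Lemma canonical_cases Y : Y ⊆ k -> is_canonical n f Y ->
  constant_on f (nsubsets n Y) \/
  exists (i : 'I_n) r,
    (forall ss v, increasing_in Y ss -> val f ss v -> op (ss i) v ∈ r) /\
    (forall x x' v, op x v ∈ r -> op x' v ∈ r -> x = x').
Proof.
move=> Yk [Dl DlP]; case: (set_0Vmem Dl) => [D0|[i iD]]; [left|right].
  move=> s t u v /(nsubsetsE _ _ Yk)[ss [hs es]] /(nsubsetsE _ _ Yk)[ts [ht et]] su tv.
  by apply/(DlP ss ts hs ht s t u v es et su tv) => i; rewrite D0 inE.
have [|r [_ rP]] := @relP Y (un (un f)) (fun x v => exists ss : 'I_n -> M,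
    (forall j, ss j ∈ Y) /\ ((forall j l : 'I_n, (j < l)%N -> ss j ∈ ss l) /\
      (ss i = x /\ val f ss v))).
  apply: (@Dfn_ex_tuple _ _ _ (fun=> Y) (fun e ss =>
    ((forall j l : 'I_n, (j < l)%N -> ss j ∈ ss l) /\ (ss i = e 1 /\ val f ss (e 0))))).
    exact: term_const.
  move=> r ts tts; apply: Dfn_and; first exact: Dfn_increasing.
  by apply: Dfn_and; [apply: Dfn_eq => //; exact: term_var|apply: Dfn_val => //; exact: term_var].
exists i, r; split=> [ss v [h1 h2] hv|x x' v].
  by apply/rP; split=> //; [exact: val_un2 hv|exists ss].
move=> /rP[_ _ [ss [s1 [s2 [<- /valE[s [es sv]]]]]]] /rP[_ _ [ts [t1 [t2 [<- /valE[t [et tv]]]]]]].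
have [hs ht] : increasing_in Y ss /\ increasing_in Y ts by [].
by have [+ _] := DlP ss ts hs ht s t v v es et sv tv; apply.
Qed.

(** Otherwise the entries related by [r] to values in [t] form a small set. Its removal leaves a
    non-small set, which contains an increasing tuple; but the value at that tuple lies in [t]. *)
Lemma Small_values Y t : Y ⊆ k -> ~ Small Y -> is_canonical n f Y ->
  Small t -> (forall s v, app f s v -> v ∈ t) -> constant_on f (nsubsets n Y).
Proof.
move=> Yk nSY /(canonical_cases Yk)[//|[i [r [r1 r2]]]] St ft.
have [|B BP] := @sepP Y (fun x => exists v, v ∈ t /\ op x v ∈ r); first by dfn.
have [|Z ZP] := @sepP Y (fun x => ~ x ∈ B); first by dfn.
have ZY : Z ⊆ Y by move=> z /ZP[].
have SB : Small B.
  apply: (@Small_inj r) St; split=> [x /BP[_ [v []]]|x _ x' _ v _]; first by exists v.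
  exact: r2.
have nSZ : ~ Small Z.
  move=> SZ; apply: nSY; apply: Small_union SB SZ => x xY.
  by case: (pselect (x ∈ B)) => xB; [left|right; apply/ZP].
have [ss hs] := large_increasing n (subset_trans ZY Yk) nSZ.
have hsY := increasing_sub ZY hs.
have [v hv] := val_total (increasing_sub Yk hsY).
have [_ []] : ss i ∈ Y /\ ~ ss i ∈ B by apply/ZP; apply: hs.1.
apply/BP; split; first exact: hsY.1.
exists v; split; last exact: r1.
by have /valE[s [_ sv]] := hv; apply: ft sv.
Qed.

End Canonical.

(** * Tightness *)

(** A Delta_0 substitute for membership in some [Hset]: any transitive superset inside [T] replaces
    the transitive closure, and an injection into [al] replaces the cardinality. *)
Definition bounded_by T al v : Prop :=
  exists t, t ∈ pw T /\ ((forall x, x ∈ t -> x ⊆ t) /\ (v ⊆ t /\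
  exists h, h ∈ pw (prod T k) /\
   ((forall x, x ∈ t -> exists u, u ∈ al /\ op x u ∈ h) /\
   ((forall x, x ∈ t -> forall u, u ∈ al -> forall u', u' ∈ al ->
      op x u ∈ h -> op x u' ∈ h -> u = u') /\
    (forall x, x ∈ t -> forall x', x' ∈ t -> forall u, u ∈ al ->
      op x u ∈ h -> op x' u ∈ h -> x = x'))))).

(* [E] is the reflexive closure of membership on [t], transported by [h] to
   [al], so that its field is the image of [t]; [Z] is the image of [v]. *)
Definition set_code al t h E Z v : Prop :=
  ((forall x, x ∈ t -> x ⊆ t) /\ (v ⊆ t /\
   ((forall x, x ∈ t -> exists u, u ∈ al /\ op x u ∈ h) /\
   ((forall x, x ∈ t -> forall u, u ∈ al -> forall u', u' ∈ al ->
      op x u ∈ h -> op x u' ∈ h -> u = u') /\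
    (forall x, x ∈ t -> forall x', x' ∈ t -> forall u, u ∈ al ->
      op x u ∈ h -> op x' u ∈ h -> x = x'))))) /\
  ((forall a, a ∈ al -> forall b, b ∈ al -> (op a b ∈ E <->
     exists x, x ∈ t /\ exists y, y ∈ t /\ ((x ∈ y \/ x = y) /\ (op x a ∈ h /\ op y b ∈ h)))) /\
   (forall a, a ∈ al -> (a ∈ Z <-> exists x, x ∈ v /\ op x a ∈ h))).

Lemma set_code_sub al t h t' h' E Z v v' x x' u :
  set_code al t h E Z v -> set_code al t' h' E Z v' ->
  x ∈ t -> x' ∈ t' -> u ∈ al -> op x u ∈ h -> op x' u ∈ h' ->
  forall z, z ∈ x -> exists z' a, [/\ z' ∈ x', a ∈ al, op z a ∈ h & op z' a ∈ h'].
Proof.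
move=> [[tt [_ [h1 [h2 h3]]]] [EP _]] [[tt' [_ [h1' [h2' h3']]]] [EP' _]].
move=> xt xt' ual xu xu' z zx; have zt := tt _ xt _ zx.
have [a [aal za]] := h1 z zt.
have /(EP' _ aal _ ual)[z' [zt' [y' [yt' [zy' [za' yu']]]]]] : op a u ∈ E.
  by apply/EP => //; exists z; split=> //; exists x; split=> //; split=> //; left.
have yx : y' = x' by apply: (h3' _ yt' _ xt' u).
subst y'; case: zy' => [zx'|zx']; first by exists z', a.
(* A reflexive pair of [E] cannot occur here: [z] and [x] would share a position, hence be equal,
   although [z] belongs to [x]. *)
subst z'; have au := h2' _ xt' a aal u ual za' xu'; subst a.
have zx' := h3 _ zt _ xt u ual za xu; subst z.
by case: (mem_irr zx).
Qed.

(** Rigidity of transitive sets, by a least mismatch: points at the same position have the same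
    members. *)
Lemma set_code_inj al t h t' h' E Z v v' :
  set_code al t h E Z v -> set_code al t' h' E Z v' -> v = v'.
Proof.
move=> c c'.
have same x x' u : x ∈ t -> x' ∈ t' -> u ∈ al -> op x u ∈ h -> op x' u ∈ h' -> x = x'.
  move=> xt0 xt0' ual0 xu0 xu0'; apply: contrapT => ne0.
  have [||y [yt [y' [yt' [a [aal [ya [ya' ne]]]]]] ymin]] := @found t x (fun x =>
      exists x', x' ∈ t' /\ exists u, u ∈ al /\ (op x u ∈ h /\ (op x' u ∈ h' /\ x <> x'))) _ xt0.
  - by dfn.
  - by exists x'; split=> //; exists u.
  have [tt _] := c.1; have [tt' _] := c'.1.
  have mem z z' b : z ∈ y -> z' ∈ t' -> b ∈ al -> op z b ∈ h -> op z' b ∈ h' -> z = z'.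
    move=> zy zt' bal zb zb'; apply: contrapT => nz; apply: (ymin z) => //.
      exact: tt yt _ zy.
    by exists z'; split=> //; exists b.
  apply: ne; apply: ext => z; split=> [zy|zy'].
    have [z' [b [zy' bal zb zb']]] := set_code_sub c c' yt yt' aal ya ya' zy.
    by rewrite (mem z z' b) //; exact: tt' yt' _ zy'.
  have [z' [b [zy bal zb' zb]]] := set_code_sub c' c yt' yt aal ya' ya zy'.
  by rewrite -(mem z' z b) //; exact: tt' yt' _ zy'.
have [[_ [vt [h1 _]]] [_ ZP]] := c; have [[_ [vt' [h1' _]]] [_ ZP']] := c'.
apply: ext => z; split=> [zv|zv'].
  have [a [aal za]] := h1 z (vt _ zv).
  have /(ZP' _ aal)[z' [zv' za']] : a ∈ Z by apply/ZP => //; exists z.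
  by rewrite (same z z' a) //; [exact: vt|exact: vt'].
have [a [aal za']] := h1' z (vt' _ zv').
have /(ZP _ aal)[z' [zv za]] : a ∈ Z by apply/ZP' => //; exists z.
by rewrite -(same z' z a) //; [exact: vt|exact: vt'].
Qed.

Lemma Small_bounded T al C : I al -> (forall v, v ∈ C -> bounded_by T al v) -> Small C.
Proof.
move=> Ial hC; pose W := prod (pw (prod al al)) (pw al).
have IW : I W by apply: I_prod; apply: I_pw => //; apply: I_prod.
have [|g [_ gP]] := @relP W C (fun c v => exists t, t ∈ pw T /\ exists h, h ∈ pw (prod T k) /\
    exists E, E ∈ pw (prod al al) /\ exists Z, Z ∈ pw al /\
      (c = op E Z /\ set_code al t h E Z v)).
  by rewrite /set_code; dfn.
exists W, g; split=> // [v vC|c v v' /gP[_ _ [t [_ [h [_ [E [_ [Z [_ [-> cv]]]]]]]]]]]; last first.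
  move=> /gP[_ _ [t' [_ [h' [_ [E' [_ [Z' [_ [/op_inj[? ?] cv']]]]]]]]]]; subst E' Z'.
  exact: set_code_inj cv cv'.
have [t [tT [tt [vt [h [hT [h1 [h2 h3]]]]]]]] := hC v vC.
have [|E [Eal EP]] := @relP al al (fun a b => exists x, x ∈ t /\ exists y, y ∈ t /\
    ((x ∈ y \/ x = y) /\ (op x a ∈ h /\ op y b ∈ h))); first by dfn.
have [|Z ZP] := @sepP al (fun a => exists x, x ∈ v /\ op x a ∈ h); first by dfn.
have EW : E ∈ pw (prod al al) by apply/in_pw.
have ZW : Z ∈ pw al by apply/in_pw => a /ZP[].
have cW : op E Z ∈ W by apply/op_prod.
exists (op E Z); split=> //; apply/gP; split=> //.
exists t; split=> //; exists h; split=> //; exists E; split=> //; exists Z; split=> //.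
split=> //; split=> //; split=> [a aal b bal|a aal]; [rewrite EP|rewrite ZP]; split=> [[]|] //.
Qed.

Lemma Hset_bounded T th al v : transitive_set T -> v ∈ T -> is_ord th -> th ⊆ al ->
  al ⊆ k -> Hset th v -> bounded_by T al v.
Proof.
move=> tT vT [tth _] thal alk [t [l [[tt vt tmin] /has_cardE[_ [h [htl [h1 [_ [h3 h4]]]]]] lth]]].
have tsT : t ⊆ T by apply: tmin => //; exact: tT.
have lal : l ⊆ al by apply: subset_trans thal; exact: tth.
exists t; split; first exact/in_pw.
split=> //; split=> //; exists h; split.
  apply/in_pw; apply: subset_trans htl _; apply: prod_mono => //.
  exact: subset_trans alk.
have hl x u : op x u ∈ h -> u ∈ l by move=> /htl/op_prod[].
split=> [x xt|]; first by have [u [ul xu]] := h1 x xt; exists u; split=> //; exact: lal.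
split=> [x xt u _ u' _ xu xu'|x xt x' xt' u _ xu xu'].
  by apply: (h3 x) => //; apply: hl; eassumption.
by apply: (h4 x _ x' _ u) => //; exact: hl xu.
Qed.

Lemma cardinal_le l b : is_cardinal l -> is_ord b -> eqv l b -> l = b \/ l ∈ b.
Proof.
move=> /cardinalE[ol lc] ob lb.
by case: (ord_lin ol ob) => [|->|/lc]; [right|left|].
Qed.

(** For [al] in [I] the values bounded by [al] form a small set, so discarding the entries that lead
    to them leaves a non-small set, into which [al] injects. Overspill yields an ordinal [th]
    outside [I] that still injects into the good entries. *)
Lemma tight_dense n f X : is_function_on f (nsubsets n k) -> X ⊆ k -> ~ Small X ->
  exists Y, [/\ Y ⊆ X, ~ Small Y & constant_on f (nsubsets n Y) \/
    exists theta, I_large I theta /\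
      forall s v, nsubsets n Y s -> app f s v -> ~ Hset theta v].
Proof.
move=> ff Xk0 nSX0; have [Y [YX nSY cY]] := canonical_dense ff Xk0 nSX0.
have Yk := subset_trans YX Xk0.
case: (canonical_cases Yk cY) => [con|[i [r [r1 r2]]]].
  by exists Y; split=> //; left.
have [T [tT fT]] := Mac_transitive_containment HM (un (un f)).
pose good al x := ~ exists v, v ∈ un (un f) /\ (op x v ∈ r /\ bounded_by T al v).
have [||th [thk nIth [h [_ [h1 h2]]]]] := @overspill k (fun al =>
    exists h, h ∈ pw (prod k k) /\
    ((forall u, u ∈ al -> exists x, x ∈ Y /\ (good al x /\ op u x ∈ h)) /\
     (forall u, u ∈ al -> forall u', u' ∈ al -> forall x, x ∈ Y ->
        op u x ∈ h -> op u' x ∈ h -> u = u'))) ok nIk.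
- by rewrite /good /bounded_by; dfn.
- move=> al oal Ial.
  have alk : al ∈ k by apply: I_ord_lt.
  have alk' : al ⊆ k by case: ok => + _; apply.
  have [|C CP] := @sepP (un (un f)) (bounded_by T al); first by rewrite /bounded_by; dfn.
  have [|B BP] := @sepP Y (fun x => exists v, v ∈ C /\ op x v ∈ r); first by dfn.
  have [|Z ZP] := @sepP Y (fun x => ~ x ∈ B); first by dfn.
  have ZY : Z ⊆ Y by move=> z /ZP[].
  have SB : Small B.
    apply: (@Small_inj r _ C); last by apply: (@Small_bounded T al) => // v /CP[].
    split=> [x /BP[_ [v []]]|x _ x' _ v _]; first by exists v.
    exact: r2.
  have nSZ : ~ Small Z.
    move=> SZ; apply: nSY; apply: Small_union SB SZ => x xY.
    by case: (pselect (x ∈ B)) => xB; [left|right; apply/ZP].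
  have Zg z : z ∈ Z -> good al z.
    move=> /ZP[zY nzB] [v [vf [zv vb]]]; apply: nzB; apply/BP; split=> //.
    by exists v; split=> //; apply/CP.
  have Zk := subset_trans ZY Yk.
  case: (inj_or_emb Zk alk) => [[h [hsub [h1 h2]]]|[h [hsub h1 h2]]].
    exists h; split; first by apply/in_pw; apply: subset_trans hsub _; apply: prod_mono.
    split=> [u ual|u ual u' ual' x xY ux ux'].
      by have [x [xZ ux]] := h1 u ual; exists x; split; [exact: ZY|split=> //; exact: Zg].
    have /op_prod[_ xZ] := hsub _ ux.
    exact: (h2 u ual u' ual' x).
  case: nSZ; apply: (@Small_inj h _ al); last exact: Small_I.
  split=> // x xZ x' xZ' u ual xu xu'.
  by case: (linear_k (Zk _ xZ) (Zk _ xZ')) => // /h2 lt; case: (@mem_irr u); apply: (lt u u).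
have oth := ord_mem ok thk.
have thk' : th ⊆ k by case: ok => + _; apply.
have nSth : ~ Small th by move=> Sth; apply: nIth; apply: Small_ord.
have [|Z ZP] := @sepP Y (good th); first by rewrite /good /bounded_by; dfn.
have ZY : Z ⊆ Y by move=> z /ZP[].
exists Z; split; first exact: subset_trans YX.
  move=> SZ; apply: nSth; apply: (@Small_inj h _ Z) => //; split=> [u uth|u uth u' uth' x xZ].
    by have [x [xY [gx ux]]] := h1 u uth; exists x; split=> //; apply/ZP.
  by apply: h2 => //; exact: ZY.
(* Overspill gives only an ordinal; its cardinal [l] is outside [I], as [th] is not small, and [l]
   is included in [th]. *)
right; have [l [lc _ thl]] := card_exists ok thk'.
exists l; split; first by split=> // Il; apply: nSth; exact: Small_eqv thl Il.
move=> s v /(nsubsetsE _ _ (subset_trans ZY Yk))[ss [hs es]] sv Hv.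
have hv : val f ss v by apply/valE; exists s.
have /ZP[_] := hs.1 i; apply; exists v; split; first exact: val_un2 hv.
split; first by apply: r1 => //; exact: increasing_sub ZY _.
have [ol _] := lc.
have lth : l ⊆ th.
  case: (cardinal_le lc oth (eqv_sym thl)) => [->//|].
  by case: oth => + _; apply.
by apply: Hset_bounded Hv => //; apply: fT; exact: val_un2 hv.
Qed.

(** If the cardinal of [X] exceeds [b], the part of [X] that a bijection sends into [b] is kept. *)
Lemma card_dense b X : is_ord b -> ~ I b -> X ⊆ k -> ~ Small X ->
  exists Y, [/\ Y ⊆ X, ~ Small Y & exists l, has_card Y l /\ (l ∈ b \/ l = b)].
Proof.
move=> ob nIb Xk nSX; have [l [lc lk Xl]] := card_exists ok Xk.
have [ol _] := lc.
case: (pselect (l ∈ b \/ l = b)) => [lb|nlb].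
  by exists X; split=> //; exists l; split=> //; apply/has_cardE.
have bl : b ⊆ l.
  case: (ord_lin ol ob) => [lb|lb|]; [by case: nlb; left|by case: nlb; right|].
  by case: ol => + _; apply.
have [h [hXl [h1 [h2 [h3 h4]]]]] := Xl.
have [|Y YP] := @sepP X (fun x => exists u, u ∈ b /\ op x u ∈ h); first by dfn.
have YX : Y ⊆ X by move=> z /YP[].
have Yb : eqv Y b.
  apply: (@bijb_eqv h); split=> [x /YP[]//|]; split=> [u ub|].
    have [x [xX xu]] := h2 u (bl _ ub).
    by exists x; split=> //; apply/YP; split=> //; exists u.
  split=> [x xY u ub u' ub'|x xY x' xY' u ub].
    by apply: (h3 x); [exact: YX|exact: bl|exact: bl].
  by apply: (h4 x); [exact: YX|exact: YX|exact: bl].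
have [m [mc _ Ym]] := card_exists ok (subset_trans YX Xk).
exists Y; split=> //.
  have [g bY] := eqv_inj (eqv_sym Yb).
  by move=> SY; apply: nIb; apply: Small_ord => //; apply: Small_inj bY SY.
exists m; split; first by apply/has_cardE.
by case: (cardinal_le mc ob (eqv_trans (eqv_sym Ym) Yb)); [right|left].
Qed.

Lemma decide_dense x X : X ⊆ k -> ~ Small X ->
  exists Y, [/\ Y ⊆ X, ~ Small Y & Y ⊆ x \/ forall z, z ∈ Y -> ~ z ∈ x].
Proof.
move=> Xk nSX.
have [|A AP] := @sepP X (fun z => z ∈ x); first by dfn.
have [|B BP] := @sepP X (fun z => ~ z ∈ x); first by dfn.
case: (pselect (Small A)) => [SA|nSA]; last first.
  by exists A; split=> //; [move=> z /AP[]|left=> z /AP[]].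
exists B; split; [by move=> z /BP[]|move=> SB|by right=> z /BP[]].
apply: nSX; apply: Small_union SA SB => z zX.
by case: (pselect (z ∈ x)) => zx; [left; apply/AP|right; apply/BP].
Qed.

(** * The ultrafilter *)

(** One family indexed by two numbers and an element of [M], so that a single enumeration serves all
    demands on the ultrafilter. *)
Definition requirement (tag n : nat) (a Y : M) : Prop :=
  match tag with
  | 0 => is_function_on a (nsubsets n k) -> is_canonical n a Y
  | 1 => is_function_on a (nsubsets n k) -> constant_on a (nsubsets n Y) \/
           exists theta, I_large I theta /\
             forall s v, nsubsets n Y s -> app a s v -> ~ Hset theta v
  | 2 => Y ⊆ a \/ forall z, z ∈ Y -> ~ z ∈ a
  | _ => is_ord a -> ~ I a -> exists l, has_card Y l /\ (l ∈ a \/ l = a)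
  end.

Lemma requirement_dense tag n a X : X ⊆ k -> ~ Small X ->
  exists Y, [/\ Y ⊆ X, ~ Small Y & requirement tag n a Y].
Proof.
move=> Xk nSX; case: tag => [|[|[|tag]]] /=.
- case: (pselect (is_function_on a (nsubsets n k))) => [fa|nfa]; last by exists X; split.
  by have [Y [YX nSY h]] := canonical_dense fa Xk nSX; exists Y.
- case: (pselect (is_function_on a (nsubsets n k))) => [fa|nfa]; last by exists X; split.
  by have [Y [YX nSY h]] := tight_dense fa Xk nSX; exists Y.
- exact: decide_dense.
- case: (pselect (is_ord a /\ ~ I a)) => [[oa nIa]|na]; last by exists X; split=> // ? ?; case: na.
  by have [Y [YX nSY h]] := card_dense oa nIa Xk nSX; exists Y.
Qed.

Lemma generic_chain (code : M -> nat) : injective code ->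
  exists X : nat -> M, [/\ forall j, X j ⊆ k, forall j, ~ Small (X j),
    forall i j, (i <= j)%N -> X j ⊆ X i
    & forall tag n a, exists j, requirement tag n a (X j)].
Proof.
move=> code_inj; pose S := {X : M | X ⊆ k /\ ~ Small X}.
(* At most one requirement has number [j], by injectivity of [pickle] and [code]; a stage without
   one keeps its set. *)
pose meets (j : nat) (Y : M) := forall (tag n : nat) a,
  j = pickle (tag, n, code a) -> requirement tag n a Y.
have step (p : nat * S) : exists Y : S, sval Y ⊆ sval p.2 /\ meets p.1 (sval Y).
  move: p => [j [X [Xk nSX]]] /=.
  case: (pselect (exists (tag n : nat) a, j = pickle (tag, n, code a))) => [[tag [n [a ja]]]|nj]; last first.
    by exists (exist _ X (conj Xk nSX)); split=> // tag n a ja; case: nj; exists tag, n, a.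
  have [Y [YX nSY h]] := requirement_dense tag n a Xk nSX.
  exists (exist _ Y (conj (subset_trans YX Xk) nSY)); split=> // tag' n' a'.
  by rewrite ja => /(pcan_inj pickleK)[<- <- /code_inj <-].
have [F FP] := choice step.
have k0 : k ⊆ k /\ ~ Small k by split=> // Sk; apply: nIk; exact: Small_ord.
pose X := fix X j : S := if j is i.+1 then F (i, X i) else exist _ k k0.
exists (fun j => sval (X j)); split=> [j|j|i j|tag n a].
- by case: (X j) => x [].
- by case: (X j) => x [].
- elim: j => [|j IHj]; first by rewrite leqn0 => /eqP->.
  rewrite leq_eqVlt => /orP[/eqP->//|/IHj h].
  by apply: subset_trans h; have [] := FP (j, X j).
- pose j := pickle (tag, n, code a); exists j.+1.
  by have [_ h] := FP (j, X j); apply: h.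
Qed.

Lemma ultrafilter_exists (code : M -> nat) : injective code ->
  exists U : set M,
    is_ultrafilter k U /\
    nonprincipal k U /\
    I_complete I k U /\
    canonically_Ramsey k U /\
    I_tight I k U /\
    downward_cofinal (cards_of U) (@Ord M `\` Ord_sub I).
Proof.
move=> /generic_chain[X [Xk nSX dec req]].
exists [set Y | Y ⊆ k /\ exists j, X j ⊆ Y].
have UX j : X j ⊆ k /\ exists i, X i ⊆ X j by split=> //; exists j.
split; [split|split; [|split; [|split; [|split]]]].
- by move=> x [].
- split; first by split=> //; exists 0.
  move=> x ex [_ [j jx]]; have [o Io _] := I_empty.
  by apply: (nSX j); apply: Small_sub (Small_I Io) => z /jx /ex.
- by move=> x y [_ [j jx]] xy yk; split=> //; exists j; exact: subset_trans xy.
- move=> x y z [xk [i ix]] [yk [j jy]] zP; split=> [w /zP[/xk]//|].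
  by exists (maxn i j) => w wX; apply/zP; split; [apply: ix|apply: jy];
    apply: dec wX; rewrite ?leq_maxl ?leq_maxr.
- move=> x y xk yP; have [j /= [jx|jx]] := req 2 0 x; [left|right].
    by split=> //; exists j.
  split=> [z /yP[]//|]; exists j => z zX.
  by apply/yP; split; [exact: Xk zX|exact: jx].
- move=> [a [ak aP]]; have [_ [j jx]] : [set Y | Y ⊆ k /\ exists j, X j ⊆ Y] (pr a a).
    by apply/aP; split=> [z /in_pr[]->//|]; apply/in_pr; left.
  exact: (nSX j) (Small_sub jx (Small_single a)).
- move=> n f a t Ia [_ _ tmin] [ff ft].
  (* The transitive closure taken in [M] lies below a transitive superset found in [I], hence in
     [I]. *)
  have [T [IT tT aT]] := I_transitive_containment Ia.
  have It : I t := I_sub IT (tmin _ tT aT).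
  have [j /= cj] := req 0 n f; exists (X j); split=> //.
  exact: (Small_values ff (Xk j) (nSX j) (cj ff) (Small_I It) ft).
- move=> n f ff; have [j /= cj] := req 0 n f; exists (X j); split=> //; exact: cj.
- move=> n f ff; have [j /= cj] := req 1 n f; exists (X j); split=> //; exact: cj.
- split=> [l [x [[xk [j jx]] /has_cardE[lc xl]]]|b [ob nb]].
    split; first by case: lc.
    by move=> /Ord_subE[Il _]; apply: (nSX j); apply: Small_sub jx _; apply: Small_eqv xl Il.
  have nIb : ~ I b by move=> Ib; apply: nb; apply/Ord_subE.
  have [j /= /(_ ob nIb)[l [Xl lb]]] := req 3 0 b.
  by exists l; split=> //; exists (X j); split; first exact: UX.
Qed.

End SetTheory.

Theorem theorem4p12 (M : Lstruct) (M_countable : countable [set: M])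
    (M_MOST : MOST M) (M_coll : collection M delta0P)
    (I : set M) (I_cut : H_cut I)
    (kappa : M) (kappa_ord : (@Ord M `\` Ord_sub I) kappa)
    (kappa_reg : is_regular_cardinal kappa) :
  exists U : set M,
    is_ultrafilter kappa U /\
    nonprincipal kappa U /\
    I_complete I kappa U /\
    canonically_Ramsey kappa U /\
    I_tight I kappa U /\
    downward_cofinal (cards_of U) (@Ord M `\` Ord_sub I).
Proof.
have [ok nk] := kappa_ord; have HM := MOST_Mac M_MOST.
have nIk : ~ I kappa by move=> Ik; apply: nk; apply/(Ord_subE I_cut).
move/countable_injP: M_countable => [code code_inj].
apply: (ultrafilter_exists HM I_cut ok nIk (code := code)) => x y xy.
by apply: code_inj xy; rewrite in_setT.
Qed.
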